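(* Let $n\ge1$ and $p,q,r,s\ge0$ be integers, and let $\boldsymbol{x}=(x_1,\dots,x_{2n})$, $\boldsymbol{a}=(a_1,\dots,a_{2n})$, $\boldsymbol{b}=(b_1,\dots,b_{2n})$, $\boldsymbol{z}=(z_1,\dots,z_{p+q})$, $\boldsymbol{c}=(c_1,\dots,c_{p+q})$, $\boldsymbol{w}=(w_1,\dots,w_{r+s})$, $\boldsymbol{d}=(d_1,\dots,d_{r+s})$ be indeterminates. Then $$ \operatorname{Pf}\left(\frac{F^{p+1,q+1}(x_i,x_j,\boldsymbol{z};a_i,a_j,\boldsymbol{c})\,F^{r+1,s+1}(x_i,x_j,\boldsymbol{w};b_i,b_j,\boldsymbol{d})}{(x_j-x_i)(1-x_ix_j)}\right)_{1\le i,j\le 2n} $$ $$ =\frac{1}{\prod_{1\le i<j\le 2n}(x_j-x_i)(1-x_ix_j)}\,F^{p,q}(\boldsymbol z;\boldsymbol c)^{n-1}F^{r,s}(\boldsymbol w;\boldsymbol d)^{n-1}\,F^{n+p,n+q}(\boldsymbol x,\boldsymbol z;\boldsymbol a,\boldsymbol c)\,F^{n+r,n+s}(\boldsymbol x,\boldsymbol w;\boldsymbol b,\boldsymbol d). $$ Here $(x_i,x_j,\boldsymbol z)$ denotes $(x_i,x_j,z_1,\dots,z_{p+q})$, and similarly for the other vectors; $(\boldsymbol x,\boldsymbol z)$ denotes concatenation. The matrix inside the Pfaffian is the skew-symmetric matrix with the given $(i,j)$ entries (the entry expression is antisymmetric in $i,j$).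
   Context: Partitions: a partition $\lambda=(\lambda_1\ge\lambda_2\ge\cdots)$ of nonnegative integers with finitely many nonzero parts; $l(\lambda)$ is the number of nonzero parts, $|\lambda|=\sum_i\lambda_i$. In Frobenius notation $\lambda=(\alpha_1,\dots,\alpha_d\,|\,\beta_1,\dots,\beta_d)$ where $d=\#\{i:\lambda_i\ge i\}$, $\alpha_i=\lambda_i-i$, $\beta_i=\lambda'_i-i$ ($\lambda'$ the conjugate partition). For an integer $m\ge 0$, $\mathcal{P}_m$ is the set of partitions $\lambda$ with $l(\lambda)\le m$ of the form $(\alpha_1,\dots,\alpha_d\,|\,\alpha_1+1,\dots,\alpha_d+1)$ (the empty partition included; $|\lambda|$ is then even). For nonnegative integers $p,q$, vectors $\boldsymbol{x}=(x_1,\dots,x_{p+q})$, $\boldsymbol{a}=(a_1,\dots,a_{p+q})$, and partitions $\lambda,\mu$ with $l(\lambda)\le p$, $l(\mu)\le q$, let $V^{p,q}_{\lambda,\mu}(\boldsymbol{x};\boldsymbol{a})$ be the $(p+q)\times(p+q)$ matrix whose $i$-th row is $$(x_i^{\lambda_p},x_i^{\lambda_{p-1}+1},\dots,x_i^{\lambda_1+p-1},\ a_ix_i^{\mu_q},a_ix_i^{\mu_{q-1}+1},\dots,a_ix_i^{\mu_1+q-1}).$$ Define $$F^{p,q}(\boldsymbol{x};\boldsymbol{a})=\sum_{\lambda\in\mathcal{P}_p,\ \mu\in\mathcal{P}_q}(-1)^{(|\lambda|+|\mu|)/2}\det V^{p,q}_{\lambda,\mu}(\boldsymbol{x};\boldsymbol{a}),$$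 with the convention that $F^{0,0}=1$ (determinant of the empty matrix). *)

(* Defs.v *)
From HB Require Import structures.
From mathcomp Require Import all_boot all_order all_algebra all_fingroup.
Set Implicit Arguments. Unset Strict Implicit. Unset Printing Implicit Defensive.
Import GRing.Theory.
Local Open Scope ring_scope.

Lemma ev_proof n (i : 'I_n) : (i.*2 < n.*2)%N.
Proof. by rewrite ltn_double. Qed.
Lemma od_proof n (i : 'I_n) : (i.*2.+1 < n.*2)%N.
Proof. by rewrite ltn_Sdouble. Qed.
Definition ev n (i : 'I_n) : 'I_(n.*2) := Ordinal (ev_proof i).
Definition od n (i : 'I_n) : 'I_(n.*2) := Ordinal (od_proof i).

(* permutations s encoding perfect matchings {s(2i),s(2i+1)} in canonical form *)
Definition pf_perm n (s : 'S_(n.*2)) : bool :=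
  [forall i : 'I_n, (s (ev i) < s (od i))%N] &&
  [forall i : 'I_n, forall j : 'I_n, ((i < j)%N ==> (s (ev i) < s (ev j))%N)].

Definition pfaffian (R : comRingType) n (A : 'M[R]_(n.*2)) : R :=
  \sum_(s : 'S_(n.*2) | pf_perm s)
     (-1) ^+ (odd_perm s) * \prod_(i < n) A (s (ev i)) (s (od i)).

(* A partition with l(lam) <= m and parts <= m is encoded by lam_1..lam_m
   (padded with zeros) as f : {ffun 'I_m -> 'I_m.+1}.  Every element of P_m
   has lam_1 = alpha_1 + 1 <= m - 1, so this box contains all of P_m. *)
Definition pseq m (f : {ffun 'I_m -> 'I_m.+1}) : seq nat :=
  [seq (val (f i)) | i <- enum 'I_m].

Definition conjp (l : seq nat) (i : nat) : nat := count (fun x => (i <= x)%N) l.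
Definition part (l : seq nat) (i : nat) : nat := nth 0%N l i.-1.
Definition durfee (l : seq nat) : nat :=
  count (fun i => (i <= part l i)%N) (iota 1 (size l)).

(* lam = (alpha_1..alpha_d | alpha_1+1..alpha_d+1),
   alpha_i = lam_i - i, beta_i = lam'_i - i *)
Definition inP m (f : {ffun 'I_m -> 'I_m.+1}) : bool :=
  let l := pseq f in
  sorted geq l &&
  all (fun i => conjp l i - i == (part l i - i).+1)%N (iota 1 (durfee l)).

(* vectors are functions nat -> R; only indices < p+q are used *)
Definition Vmat (R : comRingType) p q (x a : nat -> R) (l m : seq nat)
  : 'M[R]_(p + q) :=
  \matrix_(i < p + q, j < p + q)
    match split j with
    | inl j' => x i ^+ (nth 0%N l (p - 1 - j') + j')
    | inr k => a i * x i ^+ (nth 0%N m (q - 1 - k) + k)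
    end.

Definition Ffun (R : comRingType) p q (x a : nat -> R) : R :=
  \sum_(f : {ffun 'I_p -> 'I_p.+1} | inP f)
   \sum_(g : {ffun 'I_q -> 'I_q.+1} | inP g)
     (-1) ^+ ((sumn (pseq f) + sumn (pseq g)) %/ 2) *
     \det (Vmat p q x a (pseq f) (pseq g)).

Definition ext (R : nmodType) k (f : 'I_k -> R) : nat -> R :=
  fun i => match (insub i : option 'I_k) with Some j => f j | None => 0 end.

Definition vcat (R : Type) (k : nat) (u v : nat -> R) : nat -> R :=
  fun i => if (i < k)%N then u i else v (i - k)%N.

Definition vcons2 (R : Type) (y1 y2 : R) (v : nat -> R) : nat -> R :=
  fun i => match i with 0 => y1 | 1 => y2 | S (S k) => v k end.

(* Main.v *)
(** With u = 1 + x^2 one has (x_j - x_i)(1 - x_i x_j) = u_i x_j - u_j x_i, so (u : x) are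
    homogeneous coordinates in which the denominators become 2 x 2 minors.  Splitting P_{p+1}
    according to its first hook shows that the alternating sum over P_p turns the columns
    x^(lambda_{p-j} + j) into x^j + x^(2p-2-j), and these are unitriangular combinations of
    u^(p-1-k) x^k.  Hence F^{p,q} is a single determinant G with rows
    (u^(p-1-k) x^k | a u^(q-1-k) x^k).

    Expanding the Pfaffian along its first row and using induction on n reduces the theorem to
      sum_j G(0,j,z) G'(0,j,w) G(x\{0,j},z) G'(x\{0,j},w) prod_{l <> 0,j} [0,l][j,l]
        = G(z) G'(w) G(x,z) G'(x,w),   where [i,j] = u_i x_j - u_j x_i.
    In the affine coordinate y this is Lagrange interpolation at y_0 of a product theta * psi
    of two polynomials with theta(y_0) = G(z) G(x,z) and
    theta(y_j) = +- G(0,j,z) G(x\{0,j},z) prod_{l <> 0,j} (y_j - y_l). *)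

Require Import Defs.
From HB Require Import structures.
From mathcomp Require Import all_boot all_order all_algebra all_fingroup.
From mathcomp Require Import ring.
Set Implicit Arguments. Unset Strict Implicit. Unset Printing Implicit Defensive.
Import GRing.Theory.
Local Open Scope ring_scope.

(** * Expansion of the Pfaffian along the first row *)

Lemma lift_perm_surj n (i : 'I_n.+1) (s : 'S_n.+1) :
  exists t : 'S_n, s = lift_perm i (s i) t.
Proof.
have neq k : s i != s (lift i k) by rewrite (inj_eq perm_inj) neq_lift.
pose f k := s2val (unlift_some (neq k)).
have fE k : s (lift i k) = lift (s i) (f k) by exact: (s2valP (unlift_some (neq k))).
have f_inj : injective f.
  by move=> k l kl; apply: (@lift_inj n.+1 i); apply: (@perm_inj _ s); rewrite !fE kl.
exists (perm f_inj); apply/permP => k.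
have [l ->|->] := unliftP i k; last by rewrite lift_perm_id.
by rewrite lift_perm_lift permE fE.
Qed.

Lemma lift_perm_inj n (i j : 'I_n.+1) : injective (@lift_perm n i j).
Proof.
move=> s t st; apply/permP => k; apply: (@lift_inj n.+1 j).
by rewrite -(lift_perm_lift i) st lift_perm_lift.
Qed.

(** Permutations with a prescribed value at [i] correspond bijectively to permutations of the
    remaining points, which is the reindexing behind a row expansion. *)
Lemma sum_lift_perm (R : nmodType) n (i j : 'I_n.+1) (P : pred 'S_n.+1)
    (F : 'S_n.+1 -> R) :
  \sum_(s | P s && (s i == j)) F s
  = \sum_(t | P (lift_perm i j t)) F (lift_perm i j t).
Proof.
(* [g] inverts [lift_perm i j]; the default 1 is reached only by permutations that do not send [i]
   to [j]. *)
pose g s := odflt 1%g [pick t | s == lift_perm i j t].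
rewrite (reindex_onto (lift_perm i j) g) => [|s /andP[_ /eqP sij]]; last first.
  rewrite /g; case: pickP => [t /eqP //|/=].
  by have [t st] := lift_perm_surj i s => /(_ t); rewrite {1}st sij eqxx.
apply: eq_bigl => t; rewrite lift_perm_id eqxx andbT.
rewrite /g; case: pickP => [u /eqP/lift_perm_inj <- /=|/(_ t)]; last by rewrite eqxx.
by rewrite eqxx andbT.
Qed.

Lemma ev_lift n (i : 'I_n) : @ev n.+1 (lift ord0 i) = lift ord0 (lift ord0 (ev i)).
Proof. by apply: val_inj; rewrite /= /bump /= add1n doubleS. Qed.

Lemma od_lift n (i : 'I_n) : @od n.+1 (lift ord0 i) = lift ord0 (lift ord0 (od i)).
Proof. by apply: val_inj; rewrite /= /bump /= add1n doubleS. Qed.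

Lemma ev0 n : @ev n.+1 ord0 = ord0.
Proof. exact: val_inj. Qed.

Lemma od0 n : @od n.+1 ord0 = lift ord0 ord0.
Proof. exact: val_inj. Qed.

Lemma ev_od_cases n (k : 'I_(n.*2)) : exists i : 'I_n, k = ev i \/ k = od i.
Proof.
have kn : (k./2 < n)%N.
  rewrite -ltn_double (leq_ltn_trans _ (ltn_ord k)) //.
  by rewrite -{2}(odd_double_half k) leq_addl.
exists (Ordinal kn); case ko: (odd k); [right|left]; apply: val_inj => /=;
  by rewrite -{1}(odd_double_half k) ko.
Qed.

(** A canonical matching puts the smaller element of each pair first and orders the pairs by these
    elements, so 0 must open the first pair. *)
Lemma pf_perm0 n (s : 'S_(n.+1.*2)) : pf_perm s -> s ord0 = ord0.
Proof.
case/andP=> /forallP s1 /forallP s2.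
have [i [|] si] := @ev_od_cases n.+1 (s^-1%g ord0).
  have := s2 ord0 => /forallP /(_ i); rewrite -si permKV ltn0 implybF.
  rewrite -leqNgt leqn0 => /eqP i0; have: s (ev i) = ord0 by rewrite -si permKV.
  by rewrite (_ : i = ord0) ?ev0 //; apply: val_inj.
by have := s1 i; rewrite -si permKV ltn0.
Qed.

Lemma ltn_lift n (h : 'I_n.+1) (i j : 'I_n) : (lift h i < lift h j)%N = (i < j)%N.
Proof. by rewrite /= /bump !ltnNge leq_bump2. Qed.

(** [lift] is increasing, so the conditions on the later pairs carry over; those on the first pair
    hold because 0 is the least element. *)
Lemma pf_perm_lift n (j : 'I_(n.*2).+1) (t : 'S_(n.*2)) :
  @pf_perm n.+1 (lift_perm ord0 ord0 (lift_perm ord0 j t)) = pf_perm t.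
Proof.
set s := lift_perm _ _ _.
have sl k : s (lift ord0 (lift ord0 k)) = lift ord0 (lift j (t k)).
  by rewrite /s !lift_perm_lift.
have s0 : s ord0 = ord0 by rewrite /s lift_perm_id.
congr andb; apply/forallP/forallP => H i.
- by have := H (lift ord0 i); rewrite ev_lift od_lift !sl !ltn_lift.
- have [k ->|->] := unliftP ord0 i; last first.
    by rewrite ev0 od0 s0 /s lift_perm_lift lift_perm_id.
  by rewrite ev_lift od_lift !sl !ltn_lift.
- apply/forallP => k; have /forallP/(_ (lift ord0 k)) := H (lift ord0 i).
  by rewrite !ev_lift !sl !ltn_lift.
apply/forallP => k.
have [k' ->|->] := unliftP ord0 k; last by rewrite ltn0.
have [i' ->|->] := unliftP ord0 i; last first.
  by rewrite ev0 s0 ev_lift sl.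
by rewrite !ev_lift !sl !ltn_lift; have /forallP := H i'; apply.
Qed.

(** Two lifts remove 0 and its partner j + 1; only the second one changes the parity, by that of j,
    whence the sign. *)
Lemma pfaffian_expand (R : comNzRingType) n (A : 'M[R]_(n.+1.*2)) :
  pfaffian A = \sum_(j < n.*2.+1) (-1) ^+ j * A ord0 (lift ord0 j) *
    @pfaffian R n (\matrix_(k, l) A (lift ord0 (lift j k)) (lift ord0 (lift j l))).
Proof.
rewrite /pfaffian (eq_bigl (fun s : 'S_(n.*2.+2) => @pf_perm n.+1 s && (s ord0 == ord0))); last first.
  move=> s; have [/pf_perm0 -> //|//] := boolP (@pf_perm n.+1 s).
(* With 0 removed, the image of the new first point is the partner of 0. *)
rewrite sum_lift_perm (partition_big (fun t : 'S_(n.*2.+1) => t ord0) predT) //=.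
apply: eq_bigr => j _; rewrite sum_lift_perm big_distrr /=.
apply: eq_big => [t|t _]; first exact: pf_perm_lift.
rewrite !odd_lift_perm /= big_ord_recl ev0 od0 lift_perm_id lift_perm_lift.
rewrite lift_perm_id signr_addb signr_odd mulrACA; congr (_ * (_ * _)).
by apply: eq_bigr => i _; rewrite ev_lift od_lift !lift_perm_lift mxE.
Qed.

(** * Determinants of lists of rows *)

Lemma nth_mid T (x0 : T) s1 x s2 : nth x0 (s1 ++ x :: s2) (size s1) = x.
Proof. by rewrite nth_cat ltnn subnn. Qed.

Lemma nth_mid_neq T (x0 : T) s1 x y s2 k :
  k != size s1 -> nth x0 (s1 ++ x :: s2) k = nth x0 (s1 ++ y :: s2) k.
Proof.
move=> ks; rewrite !nth_cat; case: ltnP => // sk.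
by have: (0 < k - size s1)%N; [rewrite subn_gt0 ltn_neqAle eq_sym ks | case: (k - _)%N].
Qed.

Section SeqDet.
Variable R : comNzRingType.
Implicit Types (s t pre post : seq (nat -> R)) (f g h : nat -> R).

(** With rows in a list, inserting, moving or deleting a row is concatenation. Missing rows read as
    zero, and only the first [n] rows and columns count. *)
Definition sdet n s : R := \det (\matrix_(i < n, j < n) nth (fun=> 0) s i j).

Lemma sdet_linear n pre post f g h a b : (size pre < n)%N ->
  (forall j, (j < n)%N -> h j = a * f j + b * g j) ->
  sdet n (pre ++ h :: post) =
  a * sdet n (pre ++ f :: post) + b * sdet n (pre ++ g :: post).
Proof.
move=> pn hE.
have neq k : (lift (Ordinal pn) k : nat) != size pre.
  by rewrite eq_sym; apply: neq_bump.
apply: (@determinant_multilinear _ _ _ _ _ (Ordinal pn)).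
- by apply/rowP => j; rewrite !mxE /= !nth_mid hE.
- by apply/matrixP => i j; rewrite !mxE (nth_mid_neq _ h f) // neq.
by apply/matrixP => i j; rewrite !mxE (nth_mid_neq _ h g) // neq.
Qed.

Lemma sdet_add n pre post f g : (size pre < n)%N ->
  sdet n (pre ++ (fun j => f j + g j) :: post) =
  sdet n (pre ++ f :: post) + sdet n (pre ++ g :: post).
Proof.
move=> pn; rewrite (@sdet_linear n pre post f g (fun j => f j + g j) 1 1) //.
  by rewrite !mul1r.
by move=> j _; rewrite !mul1r.
Qed.

Lemma eq_sdet n s t :
  (forall i j, (i < n)%N -> (j < n)%N ->
     nth (fun=> 0) s i j = nth (fun=> 0) t i j) ->
  sdet n s = sdet n t.
Proof. by move=> st; congr (\det _); apply/matrixP => i j; rewrite !mxE st. Qed.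

Lemma sdet_dup n s i j : (i < j < n)%N ->
  nth (fun=> 0) s i = nth (fun=> 0) s j -> sdet n s = 0.
Proof.
move=> /andP[ij jn] sij; have iltn := ltn_trans ij jn.
apply: (@determinant_alternate _ _ _ (Ordinal iltn) (Ordinal jn)).
  by rewrite -val_eqE /= neq_ltn ij.
by move=> k; rewrite !mxE /= sij.
Qed.

Lemma sdet_dup_adj n pre post f : ((size pre).+1 < n)%N ->
  sdet n (pre ++ f :: f :: post) = 0.
Proof.
move=> pn; apply: (@sdet_dup _ _ (size pre) (size pre).+1); first by rewrite ltnSn.
by rewrite nth_mid nth_cat ltnNge leqnSn /= subSn // subnn.
Qed.

Lemma sdet_swap n pre post f g : ((size pre).+1 < n)%N ->
  sdet n (pre ++ f :: g :: post) = - sdet n (pre ++ g :: f :: post).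
Proof.
move=> pn; apply/eqP; rewrite -addr_eq0; apply/eqP.
(* Polarisation: the determinant with the row f + g in both places is zero; its expansion leaves the
   two mixed terms. *)
pose h j := f j + g j; have := @sdet_dup_adj n pre post h pn.
have addh p1 p2 : (size p1 < n)%N -> sdet n (p1 ++ h :: p2) =
  sdet n (p1 ++ f :: p2) + sdet n (p1 ++ g :: p2) by apply: sdet_add.
rewrite addh; last exact: ltnW.
rewrite -(cat_rcons f pre (h :: _)) -(cat_rcons g pre (h :: _)) !addh ?size_rcons // !cat_rcons.
by rewrite !sdet_dup_adj // add0r addr0.
Qed.

Lemma sdet_move n pre t post f : (size pre + size t < n)%N ->
  sdet n (pre ++ t ++ f :: post) = (-1) ^+ size t * sdet n (pre ++ f :: t ++ post).
Proof.
elim: t pre => [|g t IH] pre /= pn; first by rewrite mul1r.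
rewrite -cat_rcons IH ?size_rcons ?addSnnS // cat_rcons sdet_swap; last first.
  by rewrite (leq_trans _ pn) // addnS !ltnS leq_addr.
by rewrite mulrN exprS !mulNr mul1r.
Qed.

(** The cofactors along a row do not involve that row, so they may be computed with the zero row in
    its place. *)
Lemma sdet_expand n pre post : (size pre < n)%N ->
  exists c : 'I_n -> R, forall f,
    sdet n (pre ++ f :: post) = \sum_(j < n) f j * c j.
Proof.
move=> pn; pose A f := \matrix_(i < n, j < n) nth (fun=> 0) (pre ++ f :: post) i j.
exists (cofactor (A (fun=> 0)) (Ordinal pn)) => f.
rewrite /sdet -/(A f) (expand_det_row _ (Ordinal pn)); apply: eq_bigr => j _.
rewrite mxE /= nth_mid; congr (_ * (_ * \det _)); apply/matrixP => k l.
rewrite !mxE (nth_mid_neq _ f (fun=> 0)) //.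
by rewrite eq_sym; apply: neq_bump.
Qed.
End SeqDet.

Section SeqDet2.
Variable R : comNzRingType.
Implicit Types (s t pre post : seq (nat -> R)) (f g h : nat -> R).

Lemma eq_sdet_map T n (F G : T -> nat -> R) (s : seq T) :
  (forall x j, (j < n)%N -> F x j = G x j) ->
  sdet n (map F s) = sdet n (map G s).
Proof.
move=> FG; apply: eq_sdet => i j _ jn.
by elim: s i => [|x s IH] [|i] //=; apply: FG.
Qed.

Lemma sdet_tr n s : sdet n s = sdet n (mkseq (fun i j => nth (fun=> 0) s j i) n).
Proof.
rewrite /sdet -det_tr; congr (\det _); apply/matrixP => i j.
by rewrite !mxE nth_mkseq.
Qed.

Lemma sdet_scale T n (c : T -> R) (F : T -> nat -> R) (s : seq T) : size s = n ->
  sdet n (map (fun x j => c x * F x j) s) =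
  (\prod_(x <- s) c x) * sdet n (map F s).
Proof.
move=> sn; case: s sn => [|x0 s'] sn.
  by rewrite big_nil mul1r; apply: eq_sdet => i j; rewrite -sn.
set s := x0 :: s' in sn *.
rewrite (big_nth x0) sn big_mkord /sdet.
pose d := \row_(i < n) c (nth x0 s i).
have -> : \prod_(i < n) c (nth x0 s i) = \det (diag_mx d).
  by rewrite det_diag; apply: eq_bigr => i _; rewrite mxE.
rewrite -det_mulmx; congr (\det _); apply/matrixP => i j.
by rewrite mul_diag_mx !mxE !(nth_map x0) ?sn.
Qed.

Lemma sdet_delta n k s : (k < n.+1)%N ->
  sdet n.+1 ((fun j => (j == k)%:R) :: s) =
  (-1) ^+ k * sdet n (map (fun r j => r (bump k j)) s).
Proof.
move=> kn; rewrite /sdet (expand_det_row _ ord0) (bigD1 (Ordinal kn)) //=.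
rewrite big1 ?addr0 => [|j jk]; last first.
  by rewrite mxE /=; rewrite -val_eqE /= in jk; rewrite (negPf jk) mul0r.
rewrite mxE /= eqxx mul1r /cofactor /= add0n; congr (_ * \det _).
apply/matrixP => i j; rewrite !mxE /=.
have [si|si] := ltnP i (size s); first by rewrite (nth_map (fun=> 0)).
by rewrite !nth_default ?size_map.
Qed.

Definition blk N f g (j : nat) : R := if (j < N)%N then f j else g (j - N)%N.

Lemma det_utrig1 n (T : nat -> nat -> R) :
  (forall j, T j j = 1) -> (forall i j, (j < i)%N -> T i j = 0) ->
  \det (\matrix_(i < n, j < n) T i j) = 1.
Proof.
move=> T1 T0; rewrite -det_tr det_trig; last first.
  by apply/is_trig_mxP => i j ij; rewrite !mxE T0.
by apply: big1 => i _; rewrite !mxE T1.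
Qed.

(** Right multiplication by a block-diagonal matrix of determinant 1, that is, column operations
    performed separately in the two blocks. *)
Lemma sdet_block N M (T U : nat -> nat -> R) s :
  \det (\matrix_(i < N, j < N) T i j) = 1 ->
  \det (\matrix_(i < M, j < M) U i j) = 1 ->
  sdet (N + M) s = sdet (N + M) (map (fun r : nat -> R => blk N
     (fun j => \sum_(i < N) r i * T i j)
     (fun j => \sum_(i < M) r (N + i)%N * U i j)) s).
Proof.
set mT := \matrix_(i, j) T i j; set mU := \matrix_(i, j) U i j => T1 U1.
have {T1 U1} TU1 : \det (block_mx mT 0 0 mU) = 1 by rewrite det_ublock T1 U1 mulr1.
rewrite -[LHS]mulr1 -TU1 /sdet -det_mulmx; congr (\det _).
set X := \matrix_(i, j) _.
rewrite -[X]hsubmxK mul_row_block !mulmx0 add0r addr0.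
apply/matrixP => i j; rewrite [RHS]mxE.
have -> : nth (fun=> 0) (map (fun r : nat -> R => blk N
     (fun j => \sum_(i < N) r i * T i j)
     (fun j => \sum_(i < M) r (N + i)%N * U i j)) s) i j =
    blk N (fun j => \sum_(k < N) nth (fun=> 0) s i k * T k j)
      (fun j => \sum_(k < M) nth (fun=> 0) s i (N + k)%N * U k j) j.
  have [si|si] := ltnP i (size s); first by rewrite (nth_map (fun=> 0)).
  rewrite (nth_default _ (s := map _ s)) ?size_map //.
  by rewrite /blk; case: ifP => _; rewrite big1 // => k _; rewrite nth_default ?mul0r.
rewrite mxE /blk; case: splitP => k jk; rewrite jk ?ltn_ord ?ltnNge ?leq_addr /=.
  by rewrite mxE; apply: eq_bigr => l _; rewrite !mxE.
by rewrite addKn mxE; apply: eq_bigr => l _; rewrite !mxE.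
Qed.

Definition brow N a b y : nat -> R :=
  blk N (fun j => a * y ^+ j) (fun j => b * y ^+ j).

Lemma brow_split n (c d z : R) j :
  brow n c d z j = c * brow n 1 0 z j + d * brow n 0 1 z j.
Proof. by rewrite /brow /blk; case: ifP => _; rewrite !(mul0r, mul1r, mulr0, addr0, add0r). Qed.

Definition Drow N (y a b : nat -> R) l : nat -> R := brow N (a l) (b l) (y l).

(** Affine counterpart of [G] below. Each block has its own weight because dehomogenising leaves
    different powers of u in the two blocks. *)
Definition D N M (y a b : nat -> R) (s : seq nat) : R :=
  sdet (N + M) (map (Drow N y a b) s).

(* Subtracting y0 times the previous column inside each block clears the first two
   rows and extracts the factors. *)
Lemma D_double N M (y a b : nat -> R) y0 (s : seq nat) : size s = (N + M)%N ->
  sdet (N.+1 + M.+1) (brow N.+1 1 0 y0 :: brow N.+1 0 1 y0 :: map (Drow N.+1 y a b) s)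
  = (-1) ^+ N * (\prod_(l <- s) (y l - y0)) * D N M y a b s.
Proof.
move=> sz.
pose T i j : R := (i == j)%:R - y0 * (i.+1 == j)%:R.
have T1 n : \det (\matrix_(i < n, j < n) T i j) = 1.
  apply: det_utrig1 => [j|i j ji]; first by rewrite /T eqxx gtn_eqF // mulr0 subr0.
  by rewrite /T !gtn_eqF ?mulr0 ?subr0 // ltnW.
have sumT n (c y1 : R) j : (j < n)%N -> \sum_(i < n) c * y1 ^+ i * T i j =
    if j is j'.+1 then c * (y1 - y0) * y1 ^+ j' else c.
  move=> jn; rewrite /T.
  under eq_bigr => i _ do rewrite mulrBr.
  rewrite sumrB (bigD1 (Ordinal jn)) //= eqxx mulr1 big1 ?addr0; last first.
    by move=> i; rewrite -val_eqE /= => /negPf ->; rewrite mulr0.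
  case: j jn => [|j] jn.
    by rewrite big1 ?subr0 ?expr0 ?mulr1 // => i _; rewrite !mulr0.
  rewrite (bigD1 (Ordinal (ltnW jn))) //= eqxx mulr1 big1 ?addr0; last first.
    by move=> i; rewrite -val_eqE /= eqSS => /negPf ->; rewrite !mulr0.
  by rewrite exprS mulrBr mulrBl mulrA -!mulrA [y0 * _]mulrC.
rewrite (@sdet_block _ _ T T) //=.
pose Dr (a b y1 : R) := blk N.+1 (fun j => if j is j'.+1 then a * (y1 - y0) * y1 ^+ j' else a)
   (fun j => if j is j'.+1 then b * (y1 - y0) * y1 ^+ j' else b).
rewrite -map_comp.
have DrE c d y1 j : (j < N.+1 + M.+1)%N ->
   blk N.+1 (fun j0 => \sum_(i < N.+1) brow N.+1 c d y1 i * T i j0)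
    (fun j0 => \sum_(i < M.+1) brow N.+1 c d y1 (N.+1 + i)%N * T i j0) j = Dr c d y1 j.
  move=> jn; rewrite /Dr /blk; case: ltnP => jN.
    rewrite -[RHS](sumT N.+1 c y1 j jN); by apply: eq_bigr => i _; rewrite /brow /blk ltn_ord.
  rewrite -[RHS](sumT M.+1) ?ltn_subLR //; apply: eq_bigr => i _.
  by rewrite /brow /blk ltnNge leq_addr /= addKn.
(* At y0 every entry with the factor y1 - y0 vanishes, so the first two rows become unit vectors at
   the first column of each block. *)
rewrite (@eq_sdet _ _ _ [:: (fun j => (j == 0%N)%:R), (fun j => (j == N.+1)%:R) &
   map (fun l => Dr (a l) (b l) (y l)) s]); last first.
  move=> [|[|i]] j _ jn /=.
  - rewrite DrE // /Dr /blk subrr; case: ltnP => jN.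
      by case: j {jn jN} => // j; rewrite mulr0 mul0r.
    by rewrite gtn_eqF ?(leq_trans _ jN) //; case: (j - _)%N => // k; rewrite !mul0r.
  - rewrite DrE // /Dr /blk subrr; case: ltnP => jN.
      by rewrite ltn_eqF //; case: j {jn jN} => // k; rewrite !mul0r.
    by rewrite eqn_leq jN andbT -subn_eq0; case: (j - _)%N => // k; rewrite mulr0 mul0r.
  have [si|si] := ltnP i (size s); last by rewrite !nth_default ?size_map.
  by rewrite !(nth_map 0%N) //= DrE.
rewrite addSn sdet_delta // expr0 mul1r /= addnS.
rewrite (@eq_sdet _ _ _ ((fun j => (j == N)%:R) ::
  map (fun l j => Dr (a l) (b l) (y l) j.+1) s)); last first.
  move=> [|i] j _ _ /=; first by rewrite /bump /= add1n eqSS.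
  have [si|si] := ltnP i (size s); last by rewrite !nth_default ?size_map.
  by rewrite -map_comp !(nth_map 0%N).
rewrite sdet_delta ?ltnS ?leq_addr // -mulrA -sdet_scale // -map_comp.
congr (_ * _); apply: eq_sdet_map => l j _ /=.
(* The surviving columns are those other than 0 and N + 1, the first columns of the two blocks. *)
have -> : (bump N j).+1 = if (j < N)%N then j.+1 else j.+2.
  by rewrite /bump leqNgt; case: ltnP.
rewrite /Dr /Drow /brow /blk; case: (ltnP j N) => jN.
  by rewrite ltnS jN mulrA [_ * a l]mulrC.
by rewrite !ltnS ltnNge (leqW jN) /= subSS subSn // mulrA [_ * b l]mulrC.
Qed.

End SeqDet2.

(** * The interpolating polynomials *)

Definition del T j (s : seq T) := take j s ++ drop j.+1 s.

Lemma size_del T j (s : seq T) n : size s = n.+1 -> (j < n.+1)%N -> size (del j s) = n.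
Proof. by move=> sn jn; rewrite size_cat size_take size_drop sn jn subSS subnKC. Qed.

Lemma map_del T T' (f : T -> T') j s : map f (del j s) = del j (map f s).
Proof. by rewrite /del map_cat map_take map_drop. Qed.

Lemma del_split T x0 j (s : seq T) : (j < size s)%N ->
  s = take j s ++ nth x0 s j :: drop j.+1 s.
Proof. by move=> js; rewrite -drop_nth ?cat_take_drop. Qed.

Lemma nth_del T x0 j (s : seq T) k : (j < size s)%N ->
  nth x0 (del j s) k = nth x0 s (bump j k).
Proof.
move=> js; rewrite nth_cat size_takel ?(ltnW js) // /bump.
case: (ltnP k j) => kj; first by rewrite nth_take.
by rewrite nth_drop addSn subnKC.
Qed.

Lemma del_notin (T : eqType) x0 j (s : seq T) : uniq s -> (j < size s)%N ->
  nth x0 s j \notin del j s.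
Proof.
move=> us js; move: us; rewrite {1}(del_split x0 js) -cat1s uniq_catCA.
by case/andP.
Qed.

Lemma mem_del (T : eqType) x0 j k (s : seq T) :
  (j < size s)%N -> (k < size s)%N -> j != k -> nth x0 s k \in del j s.
Proof.
move=> js ks jk; rewrite mem_cat; case: (ltngtP k j) jk => // kj _.
  by rewrite -(nth_take x0 kj) mem_nth // size_take js.
by rewrite orbC -(subnKC kj) -nth_drop mem_nth // size_drop ltn_sub2r // (leq_ltn_trans kj).
Qed.

(** The difference of [P] and its interpolant [Q] vanishes at all the nodes, and its size is too
    small for that unless it is zero. *)
Lemma lagrange_seq (F : fieldType) (P : {poly F}) (ys : seq F) x :
  uniq ys -> (size P <= size ys)%N ->
  P.[x] = \sum_(j < size ys) P.[ys`_j] *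
    \prod_(l <- del j ys) ((x - l) / (ys`_j - l)).
Proof.
move=> us sP.
pose Q := \sum_(j < size ys) P.[ys`_j] *:
  \prod_(l <- del j ys) ((ys`_j - l)^-1 *: ('X - l%:P)).
have QE z : Q.[z] = \sum_(j < size ys) P.[ys`_j] *
    \prod_(l <- del j ys) ((z - l) / (ys`_j - l)).
  rewrite horner_sum; apply: eq_bigr => j _; rewrite hornerZ horner_prod.
  by congr (_ * _); apply: eq_bigr => l _; rewrite hornerZ hornerXsubC mulrC.
rewrite -QE; suff : P - Q == 0 by rewrite subr_eq0 => /eqP ->.
apply: contraT => PQ; have := max_poly_roots PQ _ us.
suff [-> sPQ] : all (root (P - Q)) ys /\ (size (P - Q)%R <= size ys)%N.
  by rewrite ltnNge sPQ => /(_ isT).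
split.
  apply/(all_nthP 0) => k ks; rewrite rootE hornerD hornerN QE.
  rewrite (bigD1 (Ordinal ks)) //= [\prod_(_ <- _) _]big1_seq; last first.
    move=> l /andP[_ ld]; apply: divff; rewrite subr_eq0; apply: contraTneq ld => <-.
    exact: del_notin.
  rewrite mulr1 big1 ?addr0 ?subrr // => j jk.
  have /(big_rem _) -> : ys`_k \in del j ys by apply: mem_del.
  by rewrite /= subrr mul0r mul0r mulr0.
rewrite (leq_trans (size_polyD _ _)) // geq_max sP size_polyN.
rewrite (leq_trans (size_sum _ _ _)) //; apply/bigmax_leqP => j _.
rewrite (leq_trans (size_scale_leq _ _)) //.
rewrite scaler_prod (leq_trans (size_scale_leq _ _)) // size_prod_XsubC.
have [n yn] : exists n, size ys = n.+1 by case: (size ys) j => [[]//|n]; exists n.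
by rewrite (size_del yn) // -yn.
Qed.

(** By cofactor expansion along the variable row, [A] collects the cofactors of the first block as
    coefficients, and [B] those of the second. *)
Lemma sdet_polys (R : comNzRingType) N M (pre post : seq (nat -> R)) :
  (size pre < N + M)%N ->
  exists A B : {poly R}, [/\ (size A <= N)%N, (size B <= M)%N &
    forall a b y, sdet (N + M) (pre ++ brow N a b y :: post) = a * A.[y] + b * B.[y]].
Proof.
move=> pn; have [c cE] := sdet_expand post pn.
exists (\poly_(j < N) (if insub j is Some k then c (lshift M k) else 0)).
exists (\poly_(j < M) (if insub j is Some k then c (rshift N k) else 0)).
split=> [||a b y]; rewrite ?size_poly // cE big_split_ord /= !horner_poly.
congr (_ + _); rewrite mulr_sumr; apply: eq_bigr => i _; rewrite /brow /blk.
  by rewrite ltn_ord valK mulrAC mulrA.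
by rewrite ltnNge leq_addr /= addKn valK mulrAC mulrA.
Qed.

Section Theta.
Variables (F : fieldType) (y a b : nat -> F) (m p q x0 : nat) (xs zs : seq nat).
Hypothesis sx : size xs = (m.*2).+1.
Hypothesis sz : size zs = (p + q)%N.
Hypothesis uy : uniq (map y (x0 :: xs ++ zs)).
Hypothesis a_neq0 : forall l, a l != 0.

Local Notation N := (m.+1 + p)%N.
Local Notation M := (m.+1 + q)%N.

(** Put a variable row of weights (a, b) at y into the small determinant (next to x0 and zs) and
    into the large one (next to xs and zs). This gives linear forms aA + bB and aM1 + bM2, and theta
    is, up to sign, the eliminant A M2 - B M1 divided by the product of the y - y_z. At a point of
    zs both forms vanish, hence so does the eliminant. At x0 the first form vanishes by a repeated
    row, at x_j the second does; one product is left, and [D_double] evaluates its factor B or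
    M2. *)
Lemma theta_exists : exists th : {poly F}, [/\ (size th <= m.+1)%N,
   th.[y x0] = D p q y a b zs * D N M y a b (x0 :: xs ++ zs) &
   forall j, (j < size xs)%N -> let xj := nth 0%N xs j in
     th.[y xj] = (-1) ^+ (j + m) * D p.+1 q.+1 y a b (x0 :: xj :: zs) *
        (\prod_(l <- del j xs) (y xj - y l)) *
        D (m + p) (m + q) y a b (del j xs ++ zs)].
Proof.
have [|A [B [sA sB AB]]] := @sdet_polys _ p.+1 q.+1 [:: Drow p.+1 y a b x0]
  (map (Drow p.+1 y a b) zs); first by rewrite addSn addnS.
have [|M1 [M2 [sM1 sM2 M12]]] := @sdet_polys _ N M [::] (map (Drow N y a b) (xs ++ zs)).
  by [].
have NM : (N + M = (size (xs ++ zs)).+1)%N.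
  by rewrite size_cat sx sz -addnn addnACA !(addSn, addnS).
have prodN (c : F) (s : seq nat) :
    \prod_(l <- s) (y l - c) = (-1) ^+ size s * \prod_(l <- s) (c - y l).
  elim: s => [|l s IH]; first by rewrite !big_nil mulr1.
  by rewrite !big_cons IH -(opprB c) mulNr mulrCA exprS mulN1r mulNr.
pose Th := A * M2 - B * M1.
have AB0 l : l \in zs -> a l * A.[y l] + b l * B.[y l] = 0.
  move=> lz; rewrite -AB; have iz := lz; rewrite -index_mem in iz.
  apply: (@sdet_dup _ _ _ 1 (index l zs).+2).
    by rewrite addSn addnS ltnS ltnS -sz.
  by rewrite /= (nth_map 0%N) ?nth_index.
have M0 l : l \in xs ++ zs -> a l * M1.[y l] + b l * M2.[y l] = 0.
  move=> lz; rewrite -M12; have iz := lz; rewrite -index_mem in iz.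
  apply: (@sdet_dup _ _ _ 0 (index l (xs ++ zs)).+1).
    by rewrite NM ltnS.
  by rewrite /= (nth_map 0%N) ?nth_index.
have ThE0 l : a l * Th.[y l] = (a l * A.[y l] + b l * B.[y l]) * M2.[y l] -
    B.[y l] * (a l * M1.[y l] + b l * M2.[y l]).
  by rewrite /Th !hornerE; ring.
have Thz : all (root Th) (map y zs).
  apply/allP => _ /mapP[l lz ->]; rewrite rootE -(mulrI_eq0 _ (lregP (a_neq0 l))).
  by rewrite ThE0 AB0 // M0 ?mem_cat ?lz ?orbT // mul0r mulr0 subr0.
have [] := uniq_roots_prod_XsubC Thz.
  rewrite uniq_rootsE; move: uy; rewrite /= map_cat cat_uniq.
  by case/andP=> _ /and3P[].
move=> th0 Th0.
have ThE z : Th.[z] = th0.[z] * \prod_(l <- zs) (z - y l).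
  rewrite Th0 hornerM horner_prod big_map; congr (_ * _).
  by apply: eq_bigr => l _; rewrite hornerXsubC.
have prod_neq0 l : y l \notin map y zs -> \prod_(k <- zs) (y l - y k) != 0.
  move=> lz; rewrite prodf_seq_neq0; apply/allP => k kz /=.
  by rewrite subr_eq0; apply: contraNneq lz => ->; apply: map_f.
(* The sign is chosen so that the value at x0 comes out with sign +1. *)
exists (- (-1) ^+ q *: th0); split.
- rewrite (leq_trans (size_scale_leq _ _)) //.
  have [->|th_neq0] := eqVneq th0 0; first by rewrite size_poly0.
  (* Both products in the eliminant have degree at most m + p + q; dividing by the p + q linear
     factors leaves degree at most m. *)
  have : (size Th <= (m + p + q).+1)%N.
    rewrite (leq_trans (size_polyD _ _)) // size_polyN geq_max.
    rewrite !(leq_trans (size_polyMleq _ _)) //.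
      rewrite (leq_trans (_ : _ <= (q.+1 + N).-1)%N) //.
        by rewrite -!subn1 leq_sub2r // leq_add.
      by rewrite !addSn /= addnC addSn.
    rewrite (leq_trans (_ : _ <= (p.+1 + M).-1)%N) //.
      by rewrite -!subn1 leq_sub2r // leq_add.
    by rewrite !(addSn, addnS) /= addnA [(p + m)%N]addnC.
  rewrite Th0 size_Mmonic ?monic_prod_XsubC // size_prod_XsubC size_map sz.
  by rewrite addnS /= -addnA -addSn leq_add2r.
- rewrite hornerZ; apply: (mulfI (a_neq0 x0)); apply: (mulIf (prod_neq0 x0 _)).
    by move: uy; rewrite /= map_cat mem_cat negb_or => /andP[/andP[]].
  set P := \prod_(l <- zs) _; set Dz := D p q _ _ _ _; set Dx := D _ _ _ _ _ (x0 :: _).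
  (* Weights (0, 1) at y x0 isolate [B]. The part of the row of x0 in the second block repeats this
     row, so only its first-block part contributes. *)
  have B0 : B.[y x0] = (-1) ^+ q * (a x0 * (P * Dz)).
    have := AB 0 1 (y x0); rewrite mul0r add0r mul1r => <- /=.
    rewrite (@sdet_linear _ _ [::] _ (brow p.+1 1 0 (y x0)) (brow p.+1 0 1 (y x0))
      _ (a x0) (b x0)) //=; last by move=> k _; apply: brow_split.
    rewrite D_double // [X in _ + _ * X](@sdet_dup _ _ _ 0 1) //; last by rewrite addSn addnS.
    rewrite mulr0 addr0 -/Dz.
    have p2 : (-1) ^+ p * (-1) ^+ p = 1 :> F by rewrite -expr2 sqrr_sign.
    rewrite prodN sz -/P exprD.
    transitivity (((-1) ^+ p * (-1) ^+ p) * ((-1) ^+ q * (a x0 * (P * Dz)))); first by ring.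
    by rewrite p2 mul1r.
  have : a x0 * (th0.[y x0] * P) = - (B.[y x0] * Dx).
    rewrite -ThE ThE0 -AB -M12 /= -/Dx [X in X * _](@sdet_dup _ _ _ 0 1) //; last by rewrite addSn addnS.
    by rewrite mul0r sub0r.
  have s2 : (-1) ^+ q * (-1) ^+ q = 1 :> F by rewrite -expr2 sqrr_sign.
  rewrite B0 => E; transitivity (- (-1) ^+ q * (a x0 * (th0.[y x0] * P))); first by ring.
  rewrite E; transitivity (((-1) ^+ q * (-1) ^+ q) * (a x0 * (Dz * Dx) * P)); first by ring.
  by rewrite s2 mul1r.
move=> j js /=; set xj := nth 0%N xs j.
have xj_in : xj \in xs by apply: mem_nth.
have yxj : y xj \notin map y zs.
  move: uy; rewrite /= map_cat cat_uniq => /andP[_ /and3P[_ /hasPn H _]].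
  by apply: contraL (map_f y xj_in) => /H.
rewrite hornerZ; apply: (mulfI (a_neq0 xj)); apply: (mulIf (prod_neq0 xj yxj)).
set P := \prod_(l <- zs) _; set Q := \prod_(l <- _) _; set Dd := D (m + p) _ _ _ _ _.
(* Same evaluation as for [B0], after the row of x_j has been moved up past j rows and swapped with
   the variable row. *)
have M2j : M2.[y xj] = - (-1) ^+ (j + m + q) * (a xj * (Q * P * Dd)).
  have := M12 0 1 (y xj); rewrite mul0r add0r mul1r => <-.
  rewrite {1}(del_split 0%N js) -catA map_cat /= -/xj.
  rewrite (@sdet_move _ _ [:: brow N 0 1 (y xj)]) /=; last first.
    rewrite size_map size_takel ?(ltnW js) // NM ltnS size_cat.
    by rewrite (leq_trans js) // leq_addr.
  rewrite -map_cat catA -/(del j xs) size_map size_takel ?(ltnW js) //.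
  rewrite (@sdet_linear _ _ [:: _] _ (brow N 1 0 (y xj)) (brow N 0 1 (y xj))
      _ (a xj) (b xj)) /=; first last.
  - by move=> k _; apply: brow_split.
  - by rewrite !addSn addnS.
  rewrite [X in _ + _ * X](@sdet_dup _ _ _ 0 1) //; last by rewrite !addSn addnS.
  rewrite mulr0 addr0.
  rewrite (@sdet_swap _ _ [::]) /=; last by rewrite !addSn addnS.
  rewrite D_double; last first.
    by rewrite size_cat sz (size_del sx) -?sx // -addnn addnACA.
  rewrite prodN big_cat /= size_cat sz (size_del sx) -?sx //.
  rewrite -/Q -/P -/Dd !exprD -muln2 exprM sqrr_sign.
  have p2 : (-1) ^+ p * (-1) ^+ p = 1 :> F by rewrite -expr2 sqrr_sign.
  transitivity (((-1) ^+ p * (-1) ^+ p) *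
    (- ((-1) ^+ j * (-1) ^+ m * (-1) ^+ q) * (a xj * (Q * P * Dd)))); first by ring.
  by rewrite p2 mul1r.
have : a xj * (th0.[y xj] * P) = D p.+1 q.+1 y a b [:: x0, xj & zs] * M2.[y xj].
  by rewrite -ThE ThE0 -AB M0 ?mem_cat ?xj_in // mulr0 subr0.
set f := D p.+1 _ _ _ _ _.
have s2 : (-1) ^+ (j + m + q) * (-1) ^+ q = (-1) ^+ (j + m) :> F.
  by rewrite exprD -mulrA -expr2 sqrr_sign mulr1.
rewrite M2j => E; transitivity (- (-1) ^+ q * (a xj * (th0.[y xj] * P))); first by ring.
rewrite E; transitivity (((-1) ^+ (j + m + q) * (-1) ^+ q) * (a xj * (f * Q * Dd) * P)); first by ring.
by rewrite s2; ring.
Qed.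

End Theta.

(** * The quadratic identity *)

(** The product of the two polynomials has size at most 2m + 1, the number of nodes, so
    interpolation is exact. The signs (-1)^(j + m) occur twice and cancel, and one of the two
    products of y_j - y_l cancels the Lagrange denominator. *)
Lemma D_quadratic (F : fieldType) (y a b a' b' : nat -> F) m p q r s x0 xs zs ws :
  size xs = m.*2.+1 -> size zs = (p + q)%N -> size ws = (r + s)%N ->
  uniq (map y (x0 :: xs ++ zs)) -> uniq (map y (x0 :: xs ++ ws)) ->
  (forall l, a l != 0) -> (forall l, a' l != 0) ->
  \sum_(j < m.*2.+1)
    D p.+1 q.+1 y a b (x0 :: nth 0%N xs j :: zs) *
    D r.+1 s.+1 y a' b' (x0 :: nth 0%N xs j :: ws) *
    D (m + p) (m + q) y a b (del j xs ++ zs) *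
    D (m + r) (m + s) y a' b' (del j xs ++ ws) *
    (\prod_(l <- del j xs) ((y x0 - y l) * (y (nth 0%N xs j) - y l)))
  = D p q y a b zs * D r s y a' b' ws *
    D (m.+1 + p) (m.+1 + q) y a b (x0 :: xs ++ zs) *
    D (m.+1 + r) (m.+1 + s) y a' b' (x0 :: xs ++ ws).
Proof.
move=> sx sz sw uz uw a_neq0 a'_neq0.
have [th [sth th0 thj]] := theta_exists b sx sz uz a_neq0.
have [ps [sps ps0 psj]] := theta_exists b' sx sw uw a'_neq0.
have ux : uniq (map y xs).
  by move: uz; rewrite /= map_cat cat_uniq => /andP[_ /and3P[]].
transitivity (th * ps).[y x0]; last by rewrite hornerM th0 ps0; ring.
rewrite (lagrange_seq _ ux); last first.
  rewrite size_map sx (leq_trans (size_polyMleq _ _)) //.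
  by rewrite -subn1 leq_subLR (leq_trans (leq_add sth sps)) // addSn addnS addnn.
rewrite size_map sx; apply: eq_bigr => j _.
have js : (j < size xs)%N by rewrite sx.
rewrite (nth_map 0%N) // hornerM thj // psj // -map_del big_map.
set xj := nth _ _ _; rewrite !big_split /= -!mulrA.
have yj l : l \in del j xs -> y xj - y l != 0.
  move=> lj; rewrite subr_eq0; apply: contraTneq (map_f y lj) => <-.
  by rewrite map_del /xj -(nth_map _ 0) // del_notin // size_map.
set P := \prod_(l <- _) (y xj - _).
have PV : P * \prod_(l <- del j xs) (y xj - y l)^-1 = 1.
  rewrite /P -big_split big1_seq //= => l lj.
  by rewrite divff // yj.
have s2 : (-1) ^+ (j + m) * (-1) ^+ (j + m) = 1 :> F by rewrite -expr2 sqrr_sign.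
set I := \prod_(l <- _) _^-1 in PV *; set Q := \prod_(l <- _) _.
set s1 := (-1) ^+ _ in s2 *.
have H t : t = (s1 * s1) * (P * I) * t by rewrite s2 PV !mul1r.
rewrite [LHS]H; ring.
Qed.

(** * Homogeneous form of the quadratic identity, for arbitrary points *)

Section Homogeneous.
Variable R : comNzRingType.
Implicit Types (u v a b : nat -> R).

(* (u l : v l) are homogeneous coordinates of the point y l = v l / u l. *)
Definition Grow N M u v a l : nat -> R :=
  blk N (fun j => u l ^+ (N - j.+1) * v l ^+ j)
        (fun j => a l * (u l ^+ (M - j.+1) * v l ^+ j)).

Definition G N M u v a (s : seq nat) : R := sdet (N + M) (map (Grow N M u v a) s).

Definition br u v l k : R := u l * v k - u k * v l.

(** Named as a proposition so that it can be transported along ring morphisms. The index [k.+1]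
    keeps the exponents of u nonnegative when the identity is dehomogenised. *)
Definition quadratic_identity u v a b k p q r s x0 xs zs ws :=
  \sum_(j < k.+1.*2.+1)
    G p.+1 q.+1 u v a (x0 :: nth 0%N xs j :: zs) *
    G r.+1 s.+1 u v b (x0 :: nth 0%N xs j :: ws) *
    G (k.+1 + p) (k.+1 + q) u v a (del j xs ++ zs) *
    G (k.+1 + r) (k.+1 + s) u v b (del j xs ++ ws) *
    (\prod_(l <- del j xs) (br u v x0 l * br u v (nth 0%N xs j) l))
  = G p q u v a zs * G r s u v b ws *
    G (k.+2 + p) (k.+2 + q) u v a (x0 :: xs ++ zs) *
    G (k.+2 + r) (k.+2 + s) u v b (x0 :: xs ++ ws).

End Homogeneous.

Section Dehomogenize.
Variable F : fieldType.
Variables u v a : nat -> F.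
Hypothesis u_neq0 : forall l, u l != 0.
Let y l := v l / u l.

(** Row scalings are allowed on both sides, since the surplus power of u may fall on either
    determinant; this avoids negative powers. *)
Lemma G_D N M (al be c d : nat -> F) s : size s = (N + M)%N ->
  (forall l, (0 < N)%N -> d l * u l ^+ N.-1 = c l * al l) ->
  (forall l, (0 < M)%N -> d l * (a l * u l ^+ M.-1) = c l * be l) ->
  (\prod_(l <- s) d l) * G N M u v a s = (\prod_(l <- s) c l) * D N M y al be s.
Proof.
move=> sz cN cM; rewrite -!sdet_scale //; apply: eq_sdet_map => l j jn.
rewrite /Grow /Drow /brow /blk.
have yE n i : (i < n)%N -> u l ^+ (n - i.+1) * v l ^+ i = u l ^+ n.-1 * y l ^+ i.
  move=> il; rewrite /y expr_div_n [LHS]mulrC [RHS]mulrCA; congr (_ * _).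
  have -> : (n.-1 = (n - i.+1) + i)%N by case: n il => // n il; rewrite subSS subnK.
  by rewrite exprD mulrK // unitrX // unitfE.
case: ltnP => jN.
  by rewrite yE // [RHS]mulrA -cN ?(leq_ltn_trans _ jN) // mulrA.
have jM : (j - N < M)%N by rewrite ltn_subLR.
by rewrite yE // [RHS]mulrA -cM ?(leq_ltn_trans _ jM) // !mulrA.
Qed.

End Dehomogenize.

(** The weights u^p and a u^q absorb the powers of u in which the two blocks differ. What remains is
    one power of u per row, and it comes out of the determinant. *)
Lemma quadratic_generic (F : fieldType) (u v a b : nat -> F) k p q r s x0 xs zs ws :
  (forall l, u l != 0) -> injective (fun l => v l / u l) ->
  size xs = k.+1.*2.+1 -> size zs = (p + q)%N -> size ws = (r + s)%N ->
  uniq (x0 :: xs ++ zs) -> uniq (x0 :: xs ++ ws) ->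
  quadratic_identity u v a b k p q r s x0 xs zs ws.
Proof.
move=> u0 y_inj sx sz sw uz uw; rewrite /quadratic_identity.
pose y l := v l / u l; pose U t := \prod_(l <- t) u l.
have prodX (t : seq nat) e : \prod_(l <- t) u l ^+ e = U t ^+ e by rewrite prodrXl.
have prod1 (t : seq nat) : \prod_(l <- t) (1 : F) = 1 by rewrite big1_seq.
pose al p l := u l ^+ p; pose be (a : nat -> F) q l := a l * u l ^+ q.
have G0 p' q' a' t : size t = (p' + q')%N ->
    D p' q' y (al p') (be a' q') t = U t * G p' q' u v a' t.
  move=> st; rewrite /U (@G_D _ u v a' u0 p' q' (al p') (be a' q') (fun=> 1)) //.
  - by rewrite prod1 mul1r.
  - by move=> l; case: p' {st} => // p' _; rewrite /al mul1r exprS.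
  by move=> l; case: q' {st} => // q' _; rewrite /be mul1r exprS mulrCA.
have GS e p' q' a' t : size t = (e.+1 + p' + (e.+1 + q'))%N ->
    G (e.+1 + p') (e.+1 + q') u v a' t =
    U t ^+ e * D (e.+1 + p') (e.+1 + q') y (al p') (be a' q') t.
  move=> st.
  have := @G_D _ u v a' u0 _ _ (al p') (be a' q') (fun l => u l ^+ e) (fun=> 1) t st.
  rewrite prod1 mul1r prodX => -> // l _; first by rewrite mul1r exprD.
  by rewrite mul1r exprD /be mulrCA.
have uyz : uniq (map y (x0 :: xs ++ zs)) by rewrite map_inj_uniq.
have uyw : uniq (map y (x0 :: xs ++ ws)) by rewrite map_inj_uniq.
have al0 e l : al e l != 0 by rewrite expf_neq0.
have := @D_quadratic _ y (al p) (be a q) (al r) (be b s) k.+1 p q r s x0 xs zs ws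
  sx sz sw uyz uyw (al0 p) (al0 r).
(* [C] is the ratio between the homogeneous and the affine right-hand sides, read off from [G0] and
   [GS]. *)
pose C := U zs ^+ k * U ws ^+ k * U xs ^+ (k.*2.+2) * u x0 ^+ (k.*2.+2).
move=> /(congr1 ( *%R C)); rewrite mulr_sumr => DQ.
have Ucat t1 t2 : U (t1 ++ t2) = U t1 * U t2 by rewrite /U big_cat.
have Ucons l t : U (l :: t) = u l * U t by rewrite /U big_cons.
have sxz : size (x0 :: xs ++ zs) = (k.+2 + p + (k.+2 + q))%N.
  by rewrite /= size_cat sx sz -addnn addnACA !(addSn, addnS).
have sxw : size (x0 :: xs ++ ws) = (k.+2 + r + (k.+2 + s))%N.
  by rewrite /= size_cat sx sw -addnn addnACA !(addSn, addnS).
transitivity (C * (D p q y (al p) (be a q) zs * D r s y (al r) (be b s) ws *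
    D (k.+2 + p) (k.+2 + q) y (al p) (be a q) (x0 :: xs ++ zs) *
    D (k.+2 + r) (k.+2 + s) y (al r) (be b s) (x0 :: xs ++ ws))); last first.
  rewrite !G0 // !GS // !Ucons !Ucat /C -addnn !exprS !exprD !exprMn; ring.
rewrite -DQ; apply: eq_bigr => j _.
have js : (j < size xs)%N by rewrite sx.
set xj := nth _ _ _.
have sd : size (del j xs) = k.+1.*2 by apply: (size_del sx).
have -> : G p.+1 q.+1 u v a [:: x0, xj & zs] = D p.+1 q.+1 y (al p) (be a q) [:: x0, xj & zs].
  by rewrite (GS 0%N) ?mul1r //= sz !(addSn, addnS).
have -> : G r.+1 s.+1 u v b [:: x0, xj & ws] = D r.+1 s.+1 y (al r) (be b s) [:: x0, xj & ws].
  by rewrite (GS 0%N) ?mul1r //= sw !(addSn, addnS).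
rewrite !GS; try by rewrite size_cat sd ?sz ?sw -addnn addnACA.
have Ud : U xs = u xj * U (del j xs).
  rewrite /U {1}(del_split 0%N js) /del !big_cat big_cons /=; ring.
have -> : \prod_(l <- del j xs) (br u v x0 l * br u v xj l) =
    (u x0 * u xj) ^+ (k.*2.+2) * U (del j xs) ^+ 2 *
    \prod_(l <- del j xs) ((y x0 - y l) * (y xj - y l)).
  have <- : \prod_(l <- del j xs) (u x0 * u xj) = (u x0 * u xj) ^+ (k.*2.+2).
    by rewrite big_const_seq count_predT sd -Monoid.iteropE.
  rewrite -prodX -!big_split /=; apply: eq_bigr => l _; rewrite /br /y.
  by field; rewrite !u0.
rewrite (Ucat (del j xs) zs) (Ucat (del j xs) ws) /C Ud.
have kk (c : F) : c ^+ (k.*2.+2) = c ^+ k * c ^+ k * c * c.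
  by rewrite -addnn !exprS exprD; ring.
rewrite !kk !exprMn; ring.
Qed.

Lemma sdet_map_rmorph (R S : comNzRingType) (phi : {rmorphism R -> S}) T n
    (f : T -> nat -> R) (s : seq T) :
  sdet n (map (fun x j => phi (f x j)) s) = phi (sdet n (map f s)).
Proof.
rewrite /sdet -det_map_mx; congr (\det _); apply/matrixP => i j; rewrite !mxE.
elim: s (i : nat) => [|x s IH] [|k] //=; rewrite rmorph0 //.
Qed.

Section QuadraticMorphism.
Variables (R S : comNzRingType) (phi : {rmorphism R -> S}).
Variables (u v a b : nat -> R) (u' v' a' b' : nat -> S).
Hypotheses (uE : forall l, u' l = phi (u l)) (vE : forall l, v' l = phi (v l)).
Hypotheses (aE : forall l, a' l = phi (a l)) (bE : forall l, b' l = phi (b l)).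

Lemma G_rmorph N M s (c : nat -> R) (c' : nat -> S) :
  (forall l, c' l = phi (c l)) -> G N M u' v' c' s = phi (G N M u v c s).
Proof.
move=> cE; rewrite /G -sdet_map_rmorph; apply: eq_sdet_map => l j _ /=.
by rewrite /Grow /blk uE vE cE; case: ifP => _; rewrite !rmorphM !rmorphXn.
Qed.

Lemma quadratic_identity_morph k p q r s x0 xs zs ws :
  quadratic_identity u v a b k p q r s x0 xs zs ws ->
  quadratic_identity u' v' a' b' k p q r s x0 xs zs ws.
Proof.
move=> /(congr1 phi); rewrite /quadratic_identity rmorph_sum !rmorphM.
rewrite !(G_rmorph _ _ _ aE) !(G_rmorph _ _ _ bE) => <-; apply: eq_bigr => j _.
rewrite !(G_rmorph _ _ _ aE) !(G_rmorph _ _ _ bE) !rmorphM rmorph_prod.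
by congr (_ * _); apply: eq_bigr => l _; rewrite /br !uE !vE !(rmorphM, rmorphB).
Qed.

(** Brings the identity back from the field of fractions to K[t], where t can then be set to 0. *)
Lemma quadratic_identity_inj k p q r s x0 xs zs ws : injective phi ->
  quadratic_identity u' v' a' b' k p q r s x0 xs zs ws ->
  quadratic_identity u v a b k p q r s x0 xs zs ws.
Proof.
move=> phi_inj H; apply: phi_inj; move: H; rewrite /quadratic_identity rmorph_sum !rmorphM.
rewrite !(G_rmorph _ _ _ aE) !(G_rmorph _ _ _ bE) => <-; apply: eq_bigr => j _.
rewrite !(G_rmorph _ _ _ aE) !(G_rmorph _ _ _ bE) !rmorphM rmorph_prod.
by congr (_ * _); apply: eq_bigr => l _; rewrite /br !uE !vE !(rmorphM, rmorphB).
Qed.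

End QuadraticMorphism.

(* Degenerate configurations (coinciding points, points at infinity) are perturbed
   to generic ones over the field of fractions of K[t]. *)
Lemma quadratic_identityP (K : fieldType) (u v a b : nat -> K) k p q r s x0 xs zs ws :
  size xs = k.+1.*2.+1 -> size zs = (p + q)%N -> size ws = (r + s)%N ->
  uniq (x0 :: xs ++ zs) -> uniq (x0 :: xs ++ ws) ->
  quadratic_identity u v a b k p q r s x0 xs zs ws.
Proof.
move=> sx sz sw uz uw.
pose ut l : {poly K} := 'X + (u l)%:P.
(* The degrees l + 2 are pairwise different, so the cross products [vt l * ut l'] and [vt l' * ut l]
   differ in size and the points are distinct. *)
pose vt l : {poly K} := 'X^(l.+2) + (v l)%:P.
pose at_ l : {poly K} := (a l)%:P; pose bt l : {poly K} := (b l)%:P.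
have su l : size (ut l) = 2%N by rewrite size_XaddC.
have sv l : size (vt l) = l.+3.
  by rewrite size_polyDl size_polyXn // (leq_ltn_trans (size_polyC_leq1 _)).
have ut0 l : ut l != 0 by rewrite -size_poly_eq0 su.
have vt0 l : vt l != 0 by rewrite -size_poly_eq0 sv.
have H : quadratic_identity ut vt at_ bt k p q r s x0 xs zs ws.
  pose phi : {rmorphism {poly K} -> {fraction {poly K}}} := @tofrac {poly K}.
  apply: (@quadratic_identity_inj _ _ phi _ _ _ _ (phi \o ut) (phi \o vt)
    (phi \o at_) (phi \o bt)) => //.
    by move=> x y /eqP; rewrite tofrac_eq => /eqP.
  apply: quadratic_generic => // [l|l l' /= /eqP]; first by rewrite /= tofrac_eq0.
  rewrite eqr_div ?tofrac_eq0 // -!tofracM tofrac_eq => /eqP/(congr1 (size \o polyseq)) /=.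
  by rewrite !size_mul // !su !sv !addn2 /= => -[].
have h0 c n : horner_eval 0 ('X^(n.+1) + c%:P : {poly K}) = c.
  by rewrite /horner_eval !hornerE expr0n add0r.
have hX c : horner_eval 0 ('X + c%:P : {poly K}) = c.
  by rewrite /horner_eval !hornerE.
have hC c : horner_eval 0 (c%:P : {poly K}) = c by rewrite /horner_eval hornerC.
apply: (quadratic_identity_morph (phi := horner_eval 0)) H => l; apply/esym.
- exact: hX.
- exact: h0.
- exact: hC.
exact: hC.
Qed.

(** * The partitions in P_m *)

Section Partitions.
Local Open Scope nat_scope.

Definition hook_cond (l : seq nat) : bool :=
  all (fun i => conjp l i - i == (part l i - i).+1) (iota 1 (durfee l)).

Definition inPl p (l : seq nat) := [&& size l == p, sorted geq l & hook_cond l].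

(* In P_{p+1} either the last part is 0, or the first hook has arm p - 1 and leg p. *)
Fixpoint Pl p : seq (seq nat) :=
  if p is p'.+1 then
    [seq rcons l 0 | l <- Pl p'] ++
    (if p' is 0 then [::] else [seq p' :: map S l | l <- Pl p'])
  else [:: [::]].

Lemma hook_cond_rcons0 l : hook_cond (rcons l 0) = hook_cond l.
Proof.
have partE i : part (rcons l 0) i = part l i.
  rewrite /part nth_rcons; case: ltngtP => // h; rewrite nth_default //.
    exact: ltnW.
  by rewrite h.
rewrite /hook_cond; have -> : durfee (rcons l 0) = durfee l.
  have p0 : part l (1 + size l) = 0 by rewrite /part nth_default.
  rewrite /durfee size_rcons -(addn1 (size l)) iotaD count_cat /= partE p0 add1n /= !addn0.
  by apply: eq_count => i; rewrite partE.
apply: eq_in_all => i; rewrite mem_iota => /andP[i0 _].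
by rewrite partE /conjp -cats1 count_cat /= leqn0 (gtn_eqF i0) !addn0.
Qed.

(** The added first hook has arm p and leg p + 1, and the remaining Frobenius coordinates are those
    of [l], shifted by one place. *)
Lemma hook_cond_hook p l : size l = p.+1 -> hook_cond (p.+1 :: map S l) = hook_cond l.
Proof.
move=> sl; set l' := _ :: _.
have partE j : 0 < j <= p.+1 -> part l' j.+1 = (part l j).+1.
  by case: j => // j /= jp; rewrite /part /= (nth_map 0) ?sl.
have conjE j : conjp l' j.+1 = (j < p.+1) + conjp l j.
  by rewrite /conjp /= count_map; congr (_ + _); apply: eq_count.
have iotaS n : iota 1 n.+1 = 1 :: map S (iota 1 n).
  exact: (congr1 (cons 1) (iotaDl 1 1 n)).
rewrite /hook_cond; have -> : durfee l' = (durfee l).+1.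
  rewrite /durfee; have -> : size l' = p.+2 by rewrite /= size_map sl.
  rewrite iotaS sl -cat1s count_cat count_map; apply: (congr1 S).
  apply: eq_in_count => j; rewrite mem_iota add1n => jp.
  by rewrite [LHS]/= partE.
have c1 : conjp l' 1 - 1 == (part l' 1 - 1).+1.
  have -> : conjp l' 1 = 1 + conjp l 0 by rewrite conjE.
  have -> : conjp l 0 = p.+1 by rewrite -sl; apply/eqP; rewrite -all_count; apply/allP.
  by rewrite /part /= addKn subn1.
rewrite iotaS -cat1s all_cat all_map; have -> : all (fun i => conjp l' i - i == (part l' i - i).+1) [:: 1].
  by apply/andP.
rewrite andTb; apply: eq_in_all => j.
rewrite mem_iota add1n => /andP[j0 jd].
rewrite -[LHS]/(conjp l' j.+1 - j.+1 == (part l' j.+1 - j.+1).+1).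
have jp : j <= p.+1.
  by rewrite -ltnS (leq_trans jd) // ltnS /durfee (leq_trans (count_size _ _)) // size_iota sl.
rewrite conjE partE ?j0 //.
(* In the boundary case j = p + 1 the new first row is too short to count, but both truncated
   differences are then 0. *)
have cl : conjp l j <= p.+1 by rewrite -sl; apply: count_size.
case: ltnP => jp'; first by rewrite add1n !subSS.
have -> : conjp l j - j = 0 by apply/eqP; rewrite subn_eq0 (leq_trans cl).
by rewrite add0n; have -> : conjp l j - j.+1 = 0 by apply/eqP; rewrite subn_eq0 (leq_trans cl) // leqW.
Qed.

Lemma geq_trans : transitive geq.
Proof. by move=> x y z /= xy zx; apply: leq_trans xy. Qed.

Lemma hook_cond_head h t : 0 < h -> hook_cond (h :: t) -> conjp (h :: t) 1 = h.+1.
Proof.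
move=> h0; rewrite /hook_cond /durfee /= {1}/part /= h0 add1n /= => /andP[/eqP].
by rewrite /part /= !subn1 (prednK h0) => <-; rewrite /conjp /= h0.
Qed.

(** A nonzero first part h forces a first column of length h + 1, which is at most p + 1. *)
Lemma inPl_lt p l : inPl p.+1 l -> all (fun x => x <= p) l.
Proof.
case/and3P=> /eqP sl so hc; case: l sl so hc => // h t [st] so hc.
have hp : h <= p.
  case: (posnP h) => [-> //|h0].
  have := hook_cond_head h0 hc; have := count_size (fun x => 1 <= x) (h :: t).
  by rewrite -/(conjp _ _) => /[swap] ->; rewrite /= st ltnS.
rewrite /= hp; apply/allP => x xt.
move: so; rewrite /= (path_sortedE geq_trans) => /andP[/allP/(_ x xt)/= xh _].
exact: leq_trans xh hp.
Qed.

(** If the last part is 0, drop it. Otherwise all p + 1 parts are positive, so the first column has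
    length p + 1 and the first part is p by [hook_cond_head]; removing the first hook leaves a
    member of P_p. *)
Lemma mem_Pl p l : (l \in Pl p) = inPl p l.
Proof.
elim: p l => [|p IH] l; first by case: l => //=; rewrite inE.
have sS t : sorted geq (map S t) = sorted geq t.
  by rewrite sorted_map; apply: eq_sorted.
rewrite /= mem_cat; apply/orP/idP.
  case=> [/mapP[l' ]|].
    rewrite IH => /and3P[/eqP sl so hc] ->; apply/and3P; split.
    - by rewrite size_rcons sl.
    - case: l' so {sl hc} => //= h t so.
      by rewrite rcons_path so.
    by rewrite hook_cond_rcons0.
  case: p IH => // p IH /mapP[l']; rewrite IH => Pl' ->.
  have := inPl_lt Pl'; case/and3P: Pl' => /eqP sl so hc bl; apply/and3P; split.
  - by rewrite /= size_map sl.
  - rewrite /= (path_sortedE geq_trans) sS so andbT all_map.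
    by apply: sub_all bl.
  by rewrite hook_cond_hook.
case/and3P=> /eqP sl so hc; case/lastP: l sl so hc => // l z; rewrite size_rcons => -[sl] so hc.
have [z0|z0] := posnP z.
  subst z; left; apply/mapP; exists l => //; rewrite IH; apply/and3P; split.
  - by rewrite sl.
  - by case: l {sl hc} so => //= h t; rewrite rcons_path => /andP[].
  by rewrite -hook_cond_rcons0.
right.
have : all (leq z) (rcons l z).
  move: so; rewrite -(revK (rcons l z)) rev_sorted rev_rcons /= all_rev.
  rewrite (path_sortedE leq_trans) /= => /andP[al _]; rewrite leqnn /=; exact: al.
have : size (rcons l z) = p.+1 by rewrite size_rcons sl.
case: (rcons l z) so hc => // h t so hc [st] /andP[zh zt].
have h0 : 0 < h by apply: leq_trans zh.
have t0 : all (leq 1) t by apply: sub_all zt => x; apply: leq_trans.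
have := hook_cond_head h0 hc; rewrite /conjp /= h0 add1n => -[].
move: (t0); rewrite all_count => /eqP ->; rewrite st => ph; subst h.
have tE : t = map S (map predn t).
  rewrite -map_comp -[LHS]map_id; apply/eq_in_map => x /(allP t0) /= x0.
  by rewrite prednK.
case: p {zh} h0 st {sl} IH so hc => // p _ st IH so hc.
apply/mapP; exists (map predn t); last by rewrite -tE.
rewrite IH; apply/and3P; split.
- by rewrite size_map st.
- by rewrite -sS -tE; apply: path_sorted so.
by rewrite -(@hook_cond_hook p) ?size_map // -tE.
Qed.

Lemma size_Pl p l : l \in Pl p -> size l = p.
Proof. by rewrite mem_Pl => /and3P[/eqP]. Qed.

(** The two halves are disjoint: lists in the first contain 0, those in the second do not. *)
Lemma uniq_Pl p : uniq (Pl p).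
Proof.
elim: p => //= p IH; rewrite cat_uniq map_inj_uniq ?IH /=; last exact: rcons_injl.
case: p IH => // p IH; rewrite map_inj_uniq ?IH ?andbT; last first.
  by move=> l l' [] /(inj_map succn_inj).
apply/hasPn => _ /mapP[l _ ->]; apply/negP => /mapP[l' _ /(congr1 (mem^~ 0))] /=.
rewrite mem_rcons inE eqxx inE => /esym H.
by have /mapP[] : 0 \in map S l by [].
Qed.

End Partitions.

(** * The alternating sum over P_m *)

Lemma sumn_hook p l : size l = p.+1 ->
  (sumn (p.+1 :: map S l) = (p.+1).*2 + sumn l)%N.
Proof.
move=> sl; rewrite /= -addnn -addnA; congr (_ + _)%N.
by rewrite -sl; elim: l {sl} => //= x l ->; rewrite !addSn addnCA addnA.
Qed.

(** Evenness makes the sign of a pair of partitions the product of the two signs. *)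
Lemma even_Pl p l : l \in Pl p -> ~~ odd (sumn l).
Proof.
elim: p l => [|p IH] l; first by rewrite inE => /eqP ->.
rewrite mem_cat => /orP[/mapP[l' /IH ol ->]|]; first by rewrite sumn_rcons addn0.
case: p IH => // p IH /mapP[l' Pl' ->]; have sl' : size l' = p.+1 by apply: size_Pl.
by rewrite sumn_hook // oddD odd_double IH.
Qed.

Lemma inP_Pl p (f : {ffun 'I_p -> 'I_p.+1}) : inP f = (pseq f \in Pl p).
Proof.
by rewrite mem_Pl /inPl size_map size_enum_ord eqxx.
Qed.

(** By [inPl_lt] all parts of a member of P_p fit in the box of the encoding, so the box loses no
    partition. *)
Lemma sum_inP (R : nmodType) p (E : seq nat -> R) :
  \sum_(f : {ffun 'I_p -> 'I_p.+1} | inP f) E (pseq f) = \sum_(l <- Pl p) E l.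
Proof.
rewrite -big_filter -(big_map (@pseq p) xpredT E); apply: perm_big; apply: uniq_perm.
- rewrite map_inj_uniq ?filter_uniq ?index_enum_uniq // => f g fg.
  apply/ffunP => i; apply: val_inj; move/eq_in_map: fg; apply.
  exact: mem_enum.
- exact: uniq_Pl.
move=> l; apply/mapP/idP => [[f]|Pll].
  by rewrite mem_filter inP_Pl => /andP[Pf _] ->.
have sl := size_Pl Pll.
pose f : {ffun 'I_p -> 'I_p.+1} := [ffun i : 'I_p => inord (nth 0%N l i)].
suff fl : l = pseq f by exists f; rewrite // mem_filter inP_Pl -fl Pll mem_index_enum.
rewrite -[LHS](mkseq_nth 0%N) sl /mkseq -val_enum_ord -map_comp; apply/eq_in_map => i _ /=.
rewrite ffunE inordK // ltnS; case: p l Pll sl {f} i => [|p] l Pll sl i; first by case: i.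
have /allP/(_ (nth 0%N l i)) : all (fun x => x <= p)%N l.
  by apply: inPl_lt; rewrite -mem_Pl.
by move=> H; apply: leqW; apply: H; rewrite mem_nth ?sl.
Qed.

Lemma PlSS p : Pl p.+2 =
  [seq rcons l 0%N | l <- Pl p.+1] ++ [seq p.+1 :: map S l | l <- Pl p.+1].
Proof. by []. Qed.

(** The beta-numbers of the partition, in the order of the columns of a block of [Vmat]. *)
Definition exps (l : seq nat) : seq nat :=
  mkseq (fun j => nth 0%N l (size l - 1 - j) + j)%N (size l).

Lemma size_exps l : size (exps l) = size l.
Proof. exact: size_mkseq. Qed.

Lemma exps_rcons0 l : exps (rcons l 0%N) = 0%N :: map S (exps l).
Proof.
rewrite /exps size_rcons /mkseq /= subn1 subn0 nth_rcons ltnn eqxx; congr (_ :: _).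
rewrite -[1%N]/(1 + 0)%N iotaDl -!map_comp; apply/eq_in_map => j; rewrite mem_iota /= => js.
rewrite -subnDA addn0 add1n addnS nth_rcons; have -> // : (size l - j.+1 < size l)%N.
by rewrite ltn_subrL (leq_ltn_trans _ js).
Qed.

Lemma exps_hook p l : size l = p -> exps (p :: map S l) = rcons (map S (exps l)) (p.*2).
Proof.
move=> sl; rewrite /exps /= size_map sl -[p.+1]addn1 /mkseq iotaD map_cat cats1 /=.
rewrite add0n addn1 subn1 /= subnn /= addnn; congr rcons.
rewrite -map_comp; apply/eq_in_map => j; rewrite mem_iota add0n => /andP[_ jp] /=.
have -> : (p - j = (p - 1 - j).+1)%N by rewrite -subnDA add1n subnSK.
by rewrite /= (nth_map 0%N) ?addSn // sl -subnDA ltn_subrL (leq_ltn_trans _ jp).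
Qed.

#[local] Arguments Pl : simpl never.
#[local] Arguments exps : simpl never.

Section Wedge.
Variable R : comNzRingType.
Implicit Types (pre post : seq (nat -> R)) (Phi : nat -> nat -> R).

Definition sgn (l : seq nat) : R := (-1) ^+ (sumn l %/ 2).

(** For [Phi k] = x^k this is x^k + x^(2p-2-k); the middle exponent p - 1 is its own partner and is
    counted once. *)
Definition Psi Phi p k : nat -> R :=
  fun i => Phi k i + (if k == p.-1 then 0 else Phi (p.-1.*2 - k)%N i).

(** Pair the two branches of [Pl p.+2]: their exponents are those of l, raised by one, preceded by 0
    or followed by 2(p + 1). Moving the last row to the front costs (-1)^(p + 1), which is exactly
    the sign of the added hook, so the two determinants add up to one with first row Phi 0 + Phi
    (2(p + 1)). Induction applies to the shifted family, which is why [Phi] is arbitrary. *)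
Lemma sum_Pl_sdet n p Phi pre post : (size pre + p <= n)%N ->
  \sum_(l <- Pl p) sgn l * sdet n (pre ++ map Phi (exps l) ++ post) =
  sdet n (pre ++ map (Psi Phi p) (iota 0 p) ++ post).
Proof.
elim: p Phi pre => [|p IH] Phi pre pn.
  by rewrite (_ : Pl 0 = [:: [::]]) // big_seq1 /sgn /= mul1r.
have pn' f : (size (rcons pre f) + p <= n)%N by rewrite size_rcons addSnnS.
case: p IH pn pn' => [|p] IH pn pn'.
  rewrite (_ : Pl 1 = [:: [:: 0%N]]) // big_seq1 /sgn /= mul1r; apply: eq_sdet => i j _ _.
  have [->|ip] := eqVneq i (size pre); first by rewrite !nth_mid /Psi /= addr0.
  by congr (_ j); apply: nth_mid_neq.
pose Phi' k := Phi k.+1; pose f k j := Phi 0%N j + Phi k j.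
pose E l := sgn l * sdet n (pre ++ map Phi (exps l) ++ post).
have step l : l \in Pl p.+1 -> E (rcons l 0%N) + E (p.+1 :: map S l) =
    sgn l * sdet n (rcons pre (f (p.+1).*2) ++ map Phi' (exps l) ++ post).
  move=> Pll; have sl : size l = p.+1 by apply: size_Pl.
  rewrite /E {1 2}/sgn sumn_rcons addn0 sumn_hook // -muln2 addnC divnDMl // exprD.
  rewrite -/(sgn l) -mulrA -mulrDr exps_rcons0 exps_hook // map_rcons cat_rcons.
  rewrite map_cons -!(@map_comp _ _ _ Phi S) muln2 cat_rcons.
  rewrite (@sdet_move _ n pre [seq (Phi \o S) i | i <- exps l] post); last first.
    by rewrite size_map size_exps sl (leq_trans _ pn) // !addnS.
  rewrite size_map size_exps sl mulrA -expr2 sqrr_sign mul1r.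
  by rewrite -sdet_add // (leq_trans _ pn) // !addnS !ltnS -addnS leq_addr.
transitivity (\sum_(l <- Pl p.+1) E (rcons l 0%N) +
    \sum_(l <- Pl p.+1) E (p.+1 :: map S l)).
  by rewrite -/(\sum_(l <- Pl p.+2) E l) PlSS big_cat !big_map.
rewrite -big_split big_seq (eq_bigr _ step) -big_seq.
rewrite IH // cat_rcons -cat_cons.
suff -> : map (Psi Phi p.+2) (iota 0 p.+2) =
    f (p.+1).*2 :: map (Psi Phi' p.+1) (iota 0 p.+1) by [].
have -> : iota 0 p.+2 = 0%N :: map S (iota 0 p.+1).
  exact: (congr1 (cons 0%N) (iotaDl 1 0 p.+1)).
rewrite map_cons -map_comp; congr (_ :: _); apply/eq_in_map => k.
rewrite mem_iota add0n => /andP[_ kp]; rewrite /Psi /Phi' /=.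
by have -> : (p.+1.*2 - k.+1 = (p.*2 - k).+1)%N;
  rewrite // doubleS subSS subSn // -addnn (leq_trans _ (leq_addr _ _)).
Qed.

End Wedge.

(** * Change of basis from x^j + x^(2p-2-j) to (1 + x^2)^(p-1-k) x^k *)

Section Basis.
Variable R : comNzRingType.

(* Coefficients of x^(2m) + 1 = sum_a lucas m a * (1 + x^2)^a * x^(m - a), from the
   recurrence 1 + x^(2m+4) = (1 + x^2) (1 + x^(2m+2)) - x^2 (1 + x^(2m)). *)
Fixpoint lucas (m a : nat) {struct m} : R :=
  match m with
  | 0 => if a == 0%N then 2%:R else 0
  | m1.+1 => match m1 with
    | 0 => (a == 1%N)%:R
    | m2.+1 => (if a is a1.+1 then lucas m1 a1 else 0) - lucas m2 a
    end
  end.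

Lemma lucasSS m a :
  lucas m.+2 a = (if a is a1.+1 then lucas m.+1 a1 else 0) - lucas m a.
Proof. by []. Qed.

Lemma lucas_gt m a : (m < a)%N -> lucas m a = 0.
Proof.
suff : (forall a, (m < a)%N -> lucas m a = 0) /\
       (forall a, (m.+1 < a)%N -> lucas m.+1 a = 0) by case=> H _ /H.
elim: m {a} => [|m [IH1 IH2]]; first by split=> [[]|[|[]]].
split=> // -[|a] // ma; rewrite lucasSS IH2 // IH1 ?subr0 //.
exact: leq_trans (ltnW ma).
Qed.

Lemma lucas_diag m : lucas m.+1 m.+1 = 1.
Proof. by elim: m => // m IH; rewrite lucasSS IH lucas_gt ?subr0 // leqnSn. Qed.

Lemma sum_lucas m (x : R) :
  \sum_(a < m.+1) lucas m a * ((1 + x ^+ 2) ^+ a * x ^+ (m - a)) = 1 + x ^+ m.*2.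
Proof.
pose S m := \sum_(a < m.+1) lucas m a * ((1 + x ^+ 2) ^+ a * x ^+ (m - a)).
suff : S m = 1 + x ^+ m.*2 /\ S m.+1 = 1 + x ^+ m.+1.*2 by case.
elim: m => [|m [IH1 IH2]].
  by split; rewrite /S !big_ord_recl big_ord0 /= ?mul0r ?add0r ?addr0 ?mul1r ?mulr1 ?expr1.
split=> //; transitivity ((1 + x ^+ 2) * S m.+1 - x ^+ 2 * S m); last first.
  by rewrite IH1 IH2 !doubleS !exprS; ring.
rewrite /S !mulr_sumr; under eq_bigr => a _ do rewrite lucasSS mulrBl.
rewrite sumrB; congr (_ - _).
  rewrite big_ord_recl mul0r add0r; apply: eq_bigr => a _.
  rewrite lift0 subSS; set U := 1 + _.
  rewrite -[LHS]/(lucas m.+1 a * _); set L := lucas _ _; set X := x ^+ _.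
  by rewrite [U ^+ _]exprS; ring.
rewrite [LHS]big_ord_recr /= [X in X + _]big_ord_recr /= !lucas_gt ?mul0r ?addr0 //.
apply: eq_bigr => a _.
rewrite [RHS]mulrCA [x ^+ 2 * _]mulrCA -exprD; congr (_ * (_ * _ ^+ _)).
by rewrite !subSn ?leqW // -ltnS ltn_ord.
Qed.

(** Differs from [lucas] only at m = 0, where the undoubled middle column requires 1 in place of
    2. *)
Definition wcoef (m a : nat) : R := if m == 0%N then (a == 0%N)%:R else lucas m a.

Lemma wcoef_gt m a : (m < a)%N -> wcoef m a = 0.
Proof. by case: m => [|m] ma; [case: a ma | apply: lucas_gt]. Qed.

Lemma wcoef_diag m : wcoef m m = 1.
Proof. by case: m => // m; apply: lucas_diag. Qed.

Lemma sum_wcoef m (x : R) :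
  \sum_(a < m.+1) wcoef m a * ((1 + x ^+ 2) ^+ a * x ^+ (m - a)) =
  1 + (if m == 0%N then 0 else x ^+ m.*2).
Proof.
case: m => [|m]; first by rewrite big_ord_recl big_ord0 /= !mulr1 !addr0.
exact: sum_lucas.
Qed.

End Basis.

Section FfunG.
Variable R : comNzRingType.

(** With m = p - 1 - j the right-hand side is y^j times 1 + y^(2m), or y^j alone when m = 0, and
    [sum_wcoef] expands the second factor; the terms with k < j have coefficient 0. *)
Lemma basis_sum p j (y : R) : (j < p)%N ->
  \sum_(k < p) (1 + y ^+ 2) ^+ (p - k.+1) * y ^+ k * wcoef R (p - j.+1) (p - k.+1) =
  y ^+ j + (if j == p.-1 then 0 else y ^+ (p.-1.*2 - j)).
Proof.
move=> jp; rewrite (reindex_inj rev_ord_inj) /=.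
have [m mE] : exists m, (p = m.+1 + j)%N.
  by exists (p - j.+1)%N; rewrite addSnnS subnK.
have revE k : (k < p)%N -> (p - (p - k.+1).+1 = k)%N.
  by move=> kp; rewrite subnSK // subKn // ltnW.
subst p; have -> : (m.+1 + j - j.+1 = m)%N by rewrite addSnnS addnK.
rewrite big_split_ord /= [X in _ + X]big1 ?addr0 => [|k _]; last first.
  by rewrite revE ?ltn_add2l // wcoef_gt ?mulr0 // ltnS leq_addr.
have -> : (j == m + j)%N = (m == 0%N).
  by rewrite -{1}[j]add0n eqn_add2r eq_sym.
transitivity (y ^+ j * (1 + (if m == 0%N then 0 else y ^+ m.*2))); last first.
  rewrite mulrDr mulr1; congr (_ + _); case: eqP => _; first by rewrite mulr0.
  by rewrite -exprD; congr (_ ^+ _); rewrite doubleD -[j.*2]addnn addnA addnK addnC.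
rewrite -sum_wcoef mulr_sumr; apply: eq_bigr => k _.
have km : (k <= m)%N by rewrite -ltnS ltn_ord.
rewrite revE; last exact: ltn_addr.
have -> : (m.+1 + j - k.+1 = j + (m - k))%N by rewrite addSn subSS addnC addnBA.
by rewrite exprD; ring.
Qed.

(** The matrix is transposed so that the alternating sum can act on rows. *)
Lemma det_Vmat p q (x a : nat -> R) l m : size l = p -> size m = q ->
  \det (Vmat p q x a l m) = sdet (p + q)
    ([seq (fun i => x i ^+ e) | e <- exps l] ++
     [seq (fun i => a i * x i ^+ e) | e <- exps m]).
Proof.
move=> sl sm; rewrite -det_tr /sdet; congr (\det _); apply/matrixP => i j; rewrite !mxE.
rewrite nth_cat size_map size_exps sl.
case: splitP => k ik; rewrite ik ?ltn_ord ?ltnNge ?leq_addr /= ?addKn;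
  by rewrite (nth_map 0%N) ?size_exps ?sl ?sm // /exps nth_mkseq ?sl ?sm.
Qed.

(** The sum over mu is evaluated with the lambda block as prefix, then the sum over lambda with the
    mu block as suffix. Transposing back, a unitriangular change of basis in each block gives
    [G]. *)
Lemma Ffun_G p q (x a : nat -> R) :
  Ffun p q x a = G p q (fun l => 1 + x l ^+ 2) x a (iota 0 (p + q)).
Proof.
pose f e i := x i ^+ e; pose g e i := a i * x i ^+ e.
transitivity (\sum_(l <- Pl p) sgn R l * \sum_(m <- Pl q) sgn R m *
    sdet (p + q) (map f (exps l) ++ map g (exps m) ++ [::])).
  rewrite /Ffun (sum_inP p (fun l => \sum_(h : {ffun 'I_q -> 'I_q.+1} | inP h)
     (-1) ^+ ((sumn l + sumn (pseq h)) %/ 2) * \det (Vmat p q x a l (pseq h)))).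
  apply: eq_big_seq => l Pll.
  rewrite (sum_inP q (fun m => (-1) ^+ ((sumn l + sumn m) %/ 2) * \det (Vmat p q x a l m))).
  rewrite mulr_sumr; apply: eq_big_seq => m Plm.
  rewrite (det_Vmat _ _ (size_Pl Pll) (size_Pl Plm)) cats0 mulrA -exprD.
  congr ((-1) ^+ _ * _); rewrite divnDl // dvdn2; exact: even_Pl Pll.
under eq_big_seq => l Pll.
  rewrite sum_Pl_sdet; last by rewrite size_map size_exps (size_Pl Pll).
  rewrite cats0.
  (* The empty prefix prepares the second use of [sum_Pl_sdet], on the sum over lambda. *)
  rewrite -[X in sdet _ X]cat0s.
  over.
rewrite sum_Pl_sdet ?leq_addr //=.
pose T n i j : R := wcoef R (n - j.+1) (n - i.+1).
have T1 n : \det (\matrix_(i < n, j < n) T n i j) = 1.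
  rewrite det_trig; first by apply: big1 => i _; rewrite mxE /T wcoef_diag.
  apply/is_trig_mxP => i j ij; rewrite mxE /T wcoef_gt //.
  by rewrite ltn_sub2l // (leq_ltn_trans ij).
rewrite /G [RHS](@sdet_block _ p q (T p) (T q)) // [LHS]sdet_tr; apply: eq_sdet => i j ni nj.
rewrite nth_mkseq // -map_comp (nth_map 0%N) ?size_iota // nth_iota // add0n /=.
rewrite nth_cat size_map size_iota /blk; case: ltnP => jp.
  rewrite (nth_map 0%N) ?size_iota // nth_iota // add0n /Psi /f -basis_sum //.
  by apply: eq_bigr => k _; rewrite /Grow /blk ltn_ord.
have jq : (j - p < q)%N by rewrite ltn_subLR.
rewrite (nth_map 0%N) ?size_iota // nth_iota // add0n /Psi /g.
transitivity (a i * (x i ^+ (j - p) + (if (j - p)%N == q.-1 then 0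
   else x i ^+ (q.-1.*2 - (j - p))))).
  by rewrite mulrDr; case: eqP; rewrite ?mulr0.
rewrite -basis_sum // mulr_sumr; apply: eq_bigr => k _.
by rewrite /Grow /blk ltnNge leq_addr /= addKn [LHS]mulrA.
Qed.

End FfunG.

(** * Induction on n *)

Section PairProduct.
Variables (R : comNzRingType) (f : nat -> nat -> R).

Fixpoint pair_prod (s : seq nat) : R :=
  if s is x :: s' then (\prod_(l <- s') f x l) * pair_prod s' else 1.

Lemma prod_del j s (g : nat -> R) : (j < size s)%N ->
  \prod_(l <- s) g l = g (nth 0%N s j) * \prod_(l <- del j s) g l.
Proof.
move=> js; rewrite {1}(del_split 0%N js) /del !big_cat big_cons /=; ring.
Qed.

(** Entry j is the second argument in its factors with the j earlier entries; reversing these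
    factors gives the sign. *)
Lemma pair_prod_del j s : (forall k l, f k l = - f l k) -> (j < size s)%N ->
  pair_prod s = (-1) ^+ j * (\prod_(l <- del j s) f (nth 0%N s j) l) * pair_prod (del j s).
Proof.
move=> fN; elim: s j => // x s IH [|j] js; first by rewrite /del take0 /= drop0 mul1r.
rewrite ltnS in js; rewrite [LHS]/= (IH j js) (prod_del (f x) js).
have -> : del j.+1 (x :: s) = x :: del j s by [].
by rewrite big_cons /= (fN _ x) exprS; ring.
Qed.

Lemma pair_prodE s : pair_prod s = \prod_(i < size s) \prod_(j < size s | (i < j)%N)
  f (nth 0%N s i) (nth 0%N s j).
Proof.
elim: s => [|x s IH]; first by rewrite big_ord0.
rewrite [size _]/= big_ord_recl [LHS]/=; congr (_ * _).
  by rewrite [RHS]big_mkcond big_ord_recl /= mul1r (big_nth 0%N) big_mkord.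
rewrite IH; apply: eq_bigr => i _.
by rewrite [RHS]big_mkcond big_ord_recl /= mul1r [LHS]big_mkcond.
Qed.

End PairProduct.

Lemma pfaffian0 (R : comNzRingType) (A : 'M[R]_(0.*2)) : pfaffian A = 1.
Proof.
rewrite /pfaffian (big_pred1 1%g) => [|s]; first by rewrite odd_perm1 big_ord0 mul1r.
have -> : s = 1%g by apply/permP => -[].
by rewrite /= eqxx; apply/andP; split; apply/forallP => -[].
Qed.

(** Expand along the first row and apply the induction hypothesis to each minor. The sign (-1)^j of
    the expansion cancels that of [pair_prod_del], and over the common denominator the sum is the
    left side of [quadratic_identity]. *)
Lemma pfaffian_G (K : fieldType) (u v a b : nat -> K) p q r s zs ws n xs :
  size zs = (p + q)%N -> size ws = (r + s)%N -> size xs = n.+1.*2 ->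
  uniq (xs ++ zs) -> uniq (xs ++ ws) ->
  {in xs &, forall k l, k != l -> br u v k l != 0} ->
  @pfaffian K n.+1 (\matrix_(i, j)
     (G p.+1 q.+1 u v a (nth 0%N xs i :: nth 0%N xs j :: zs) *
      G r.+1 s.+1 u v b (nth 0%N xs i :: nth 0%N xs j :: ws) /
      br u v (nth 0%N xs i) (nth 0%N xs j)))
  = (pair_prod (br u v) xs)^-1 * G p q u v a zs ^+ n * G r s u v b ws ^+ n *
    G (n.+1 + p) (n.+1 + q) u v a (xs ++ zs) *
    G (n.+1 + r) (n.+1 + s) u v b (xs ++ ws).
Proof.
move=> sz sw; elim: n xs => [|n IH] [//|x0 xs] [sx] uz uw brN.
  case: xs sx uz uw brN => [//|x1 [|//]] _ _ _ _.
  rewrite pfaffian_expand big_ord_recl big_ord0 pfaffian0 mxE /= !big_cons !big_nil.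
  by rewrite !mulr1 !mul1r addr0 mulrC mulrA.
rewrite pfaffian_expand.
have brC k l : br u v k l = - br u v l k by rewrite /br opprB.
have [x0xs uxs] : x0 \notin xs /\ uniq xs.
  by move: uz; rewrite cat_uniq => /and3P[/andP[]].
have Q := @quadratic_identityP K u v a b n p q r s x0 xs zs ws sx sz sw uz uw.
transitivity ((pair_prod (br u v) (x0 :: xs))^-1 * G p q u v a zs ^+ n *
   G r s u v b ws ^+ n * (G p q u v a zs * G r s u v b ws *
    G (n.+2 + p) (n.+2 + q) u v a (x0 :: xs ++ zs) *
    G (n.+2 + r) (n.+2 + s) u v b (x0 :: xs ++ ws))); last by rewrite !exprS /=; ring.
rewrite -Q mulr_sumr; apply: eq_bigr => j _.
have js : (j < size xs)%N by rewrite sx.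
have dsub : {subset del j xs <= xs}.
  by move=> l; rewrite mem_cat => /orP[/mem_take|/mem_drop].
rewrite mxE [nth _ _ ord0]/= [nth _ _ (lift _ _)]/=.
set xj := nth 0%N xs j.
have xjx : xj \in xs by apply: mem_nth.
have usub t : uniq (x0 :: xs ++ t) -> uniq (del j xs ++ t).
  apply: subseq_uniq; rewrite -cat1s catA; apply: cat_subseq => //.
  rewrite cat1s; apply: (subseq_trans _ (subseq_cons _ _)).
  rewrite {2}(del_split 0%N js); apply: cat_subseq => //; exact: subseq_cons.
set f := G p.+1 _ _ _ _ _; set f' := G r.+1 _ _ _ _ _.
have -> : (\matrix_(k, l) (\matrix_(i, j)
     (G p.+1 q.+1 u v a (nth 0%N (x0 :: xs) i :: nth 0%N (x0 :: xs) j :: zs) *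
      G r.+1 s.+1 u v b (nth 0%N (x0 :: xs) i :: nth 0%N (x0 :: xs) j :: ws) /
      br u v (nth 0%N (x0 :: xs) i) (nth 0%N (x0 :: xs) j)))
        (lift ord0 (lift j k)) (lift ord0 (lift j l))) =
  \matrix_(i < n.+1.*2, k < n.+1.*2)
     (G p.+1 q.+1 u v a (nth 0%N (del j xs) i :: nth 0%N (del j xs) k :: zs) *
      G r.+1 s.+1 u v b (nth 0%N (del j xs) i :: nth 0%N (del j xs) k :: ws) /
      br u v (nth 0%N (del j xs) i) (nth 0%N (del j xs) k)).
  by apply/matrixP => k l; rewrite !mxE !nth_del.
rewrite IH ?usub //; last first.
- by move=> k l /dsub kx /dsub lx; apply: brN; rewrite inE ?kx ?lx orbT.
- exact: (size_del sx).
set Gd := G _ _ _ _ _ (_ ++ zs); set Gd' := G _ _ _ _ _ (_ ++ ws).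
have ppE : pair_prod (br u v) (x0 :: xs) = (-1) ^+ j * (br u v x0 xj *
    (\prod_(l <- del j xs) (br u v x0 l * br u v xj l)) * pair_prod (br u v) (del j xs)).
  by rewrite /= (pair_prod_del brC js) (prod_del _ js) -/xj big_split /=; ring.
have P0 : \prod_(l <- del j xs) (br u v x0 l * br u v xj l) != 0.
  rewrite prodf_seq_neq0; apply/allP => l ld /=; have lx := dsub _ ld.
  rewrite mulf_neq0 // brN ?inE ?eqxx ?lx ?xjx ?orbT //.
    by apply: contraNneq x0xs => ->.
  by apply: contraTneq ld => <-; apply: del_notin.
rewrite ppE; set P := \prod_(l <- _) _ in P0 *.
rewrite !invfM invr_sign.
(* Inserting P^-1 P puts the j-th term over the common denominator; the factor [P] is the product
   that appears in the quadratic identity. *)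
have PV t : t = P^-1 * P * t by rewrite mulVf ?mul1r.
rewrite [LHS]PV; ring.
Qed.

(** [G] sees the vectors only through the labels in its list, so all the instances of F can share
    one set of coordinates. *)
Lemma Ffun_relabel (R : comNzRingType) p q (x a : nat -> R) (X A : nat -> R) (s : seq nat) :
  size s = (p + q)%N ->
  (forall i, (i < p + q)%N -> x i = X (nth 0%N s i) /\ a i = A (nth 0%N s i)) ->
  Ffun p q x a = G p q (fun l => 1 + X l ^+ 2) X A s.
Proof.
move=> sz E; rewrite Ffun_G; apply: eq_sdet => i j ni _.
rewrite !(nth_map 0%N) ?size_iota ?sz // nth_iota // add0n.
by have [xE aE] := E i ni; rewrite /Grow /blk xE aE.
Qed.

(** * Specialisation to the vectors of the theorem *)

Unset Implicit Arguments. Set Strict Implicit. Set Printing Implicit Defensive.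

Theorem mainTheorem2 (R : fieldType) (n p q r s : nat)
  (x a b : 'I_(n.*2) -> R) (z c : 'I_(p + q) -> R) (w d : 'I_(r + s) -> R) :
  (0 < n)%N ->
  (forall i j : 'I_(n.*2), (i < j)%N -> (x j - x i) * (1 - x i * x j) != 0) ->
  pfaffian (\matrix_(i < n.*2, j < n.*2)
     (Ffun p.+1 q.+1 (vcons2 (x i) (x j) (ext z)) (vcons2 (a i) (a j) (ext c)) *
      Ffun r.+1 s.+1 (vcons2 (x i) (x j) (ext w)) (vcons2 (b i) (b j) (ext d)) /
      ((x j - x i) * (1 - x i * x j))))
  = (\prod_(i < n.*2) \prod_(j < n.*2 | (i < j)%N) ((x j - x i) * (1 - x i * x j)))^-1 *
    Ffun p q (ext z) (ext c) ^+ n.-1 * Ffun r s (ext w) (ext d) ^+ n.-1 *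
    Ffun (n + p) (n + q) (vcat n.*2 (ext x) (ext z)) (vcat n.*2 (ext a) (ext c)) *
    Ffun (n + r) (n + s) (vcat n.*2 (ext x) (ext w)) (vcat n.*2 (ext b) (ext d)).
Proof.
case: n x a b => [//|n] x a b _ xN; set N := n.+1.*2.
(* Labels below N carry the x-part, the next p + q the z-part and the next r + s the w-part, so each
   F becomes a [G] on a sublist of labels. *)
pose glue (y : 'I_N -> R) (t : 'I_(p + q) -> R) (t' : 'I_(r + s) -> R) : nat -> R :=
  vcat N (ext y) (vcat (p + q) (ext t) (ext t')).
pose X := glue x z w; pose A := glue a c d; pose B := glue b c d.
pose xs := iota 0 N; pose zs := iota N (p + q); pose ws := iota (N + (p + q)) (r + s).
have glueN (y : 'I_N -> R) t t' (i : 'I_N) : glue y t t' i = y i.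
  by rewrite /glue /vcat ltn_ord /ext valK.
have glue_l (y : 'I_N -> R) t t' i : (i < N)%N -> glue y t t' i = ext y i.
  by rewrite /glue /vcat => ->.
have glue_z (y : 'I_N -> R) t t' i : (i < p + q)%N -> glue y t t' (nth 0%N zs i) = ext t i.
  by move=> ip; rewrite nth_iota // /glue /vcat ltnNge leq_addr /= addKn ip.
have glue_w (y : 'I_N -> R) t t' i : (i < r + s)%N -> glue y t t' (nth 0%N ws i) = ext t' i.
  move=> ip; rewrite nth_iota // /glue /vcat -addnA ltnNge leq_addr /= addKn.
  by rewrite ltnNge leq_addr /= addKn.
have sz : size zs = (p + q)%N by rewrite size_iota.
have sw : size ws = (r + s)%N by rewrite size_iota.
have sx : size xs = N by rewrite size_iota.
have uz : uniq (xs ++ zs) by rewrite -iotaD iota_uniq.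
have uw : uniq (xs ++ ws).
  rewrite cat_uniq !iota_uniq andbT; apply/hasPn => l; rewrite !mem_iota -leqNgt.
  by case/andP=> Nl _; rewrite add0n (leq_trans (leq_addr _ _) Nl).
pose u l := 1 + X l ^+ 2.
have brE (i j : 'I_N) : br u X i j = (x j - x i) * (1 - x i * x j).
  by rewrite /br /u /X !glueN; ring.
have brN : {in xs &, forall k l, k != l -> br u X k l != 0}.
  move=> k l; rewrite !mem_iota !add0n /= => kN lN kl.
  (* The hypothesis covers only increasing pairs; the antisymmetry of [br] gives the others. *)
  have := brE (Ordinal kN) (Ordinal lN); have := brE (Ordinal lN) (Ordinal kN) => /= brlk brkl.
  case: (ltngtP k l) kl => // kl _; first by rewrite brkl xN.
  by rewrite -oppr_eq0 /br opprB -/(br u X l k) brlk xN.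
have nx i : (i < N)%N -> nth 0%N xs i = i by move=> iN; rewrite nth_iota.
have Fz : Ffun p q (ext z) (ext c) = G p q u X A zs.
  by apply: Ffun_relabel => // i ip; rewrite /X /A !glue_z.
have Fw : Ffun r s (ext w) (ext d) = G r s u X B ws.
  by apply: Ffun_relabel => // i ip; rewrite /X /B !glue_w.
have Fxz : Ffun (n.+1 + p) (n.+1 + q) (vcat N (ext x) (ext z)) (vcat N (ext a) (ext c))
    = G (n.+1 + p) (n.+1 + q) u X A (xs ++ zs).
  have sxz : size (xs ++ zs) = (n.+1 + p + (n.+1 + q))%N.
    by rewrite size_cat sx sz addnACA addnn.
  apply: Ffun_relabel => // i; rewrite -sxz size_cat sx sz nth_cat sx /vcat => ip.
  case: ltnP => iN; first by rewrite nx // /X /A !glue_l.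
  by rewrite /X /A !glue_z // ltn_subLR.
have Fxw : Ffun (n.+1 + r) (n.+1 + s) (vcat N (ext x) (ext w)) (vcat N (ext b) (ext d))
    = G (n.+1 + r) (n.+1 + s) u X B (xs ++ ws).
  have sxw : size (xs ++ ws) = (n.+1 + r + (n.+1 + s))%N.
    by rewrite size_cat sx sw addnACA addnn.
  apply: Ffun_relabel => // i; rewrite -sxw size_cat sx sw nth_cat sx /vcat => ip.
  case: ltnP => iN; first by rewrite nx // /X /B !glue_l.
  by rewrite /X /B !glue_w // ltn_subLR.
have Fij (i j : 'I_N) : Ffun p.+1 q.+1 (vcons2 (x i) (x j) (ext z)) (vcons2 (a i) (a j) (ext c))
    = G p.+1 q.+1 u X A (val i :: val j :: zs).
  apply: Ffun_relabel => [|[|[|k]]]; rewrite /= ?sz ?addSn ?addnS // => kp.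
  - by rewrite /X /A !glueN.
  - by rewrite /X /A !glueN.
  by rewrite /X /A !glue_z.
have Fij' (i j : 'I_N) : Ffun r.+1 s.+1 (vcons2 (x i) (x j) (ext w)) (vcons2 (b i) (b j) (ext d))
    = G r.+1 s.+1 u X B (val i :: val j :: ws).
  apply: Ffun_relabel => [|[|[|k]]]; rewrite /= ?sw ?addSn ?addnS // => kp.
  - by rewrite /X /B !glueN.
  - by rewrite /X /B !glueN.
  by rewrite /X /B !glue_w.
rewrite Fz Fw Fxz Fxw /=.
have -> : \prod_(i < N) \prod_(j < N | (i < j)%N) ((x j - x i) * (1 - x i * x j)) =
    pair_prod (br u X) xs.
  rewrite pair_prodE sx; apply: eq_bigr => i _; apply: eq_bigr => j _.
  by rewrite !nx // brE.
rewrite -(pfaffian_G A B sz sw sx uz uw brN); congr (@pfaffian _ n.+1 _).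
by apply/matrixP => i j; rewrite !mxE Fij Fij' !nx // brE.
Qed.
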